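(* Let $D_R$ be a precompact extrinsic $R$-ball centered at $p$ in $P^m\subset N^n$, let $M^m_W=C^m_{w,g,h}$ be an isoperimetric comparison space constructed on an interval $I$ with $R\in I$, $R>0$, and let $B^W_{T(R)}$ be the Schwarz symmetrization of $D_R$ in $M^m_W$, i.e. the geodesic ball centered at $p_W$ with $\operatorname{Vol}(B^W_{T(R)})=\operatorname{Vol}(D_R)$. Let $\psi:[0,R]\to\mathbb R$ be the smooth solution of the problem $$\operatorname{L}\psi=-1\ \text{ on } [0,R],\qquad \psi(R)=0,$$ where $\operatorname{L}f(r)=f''(r)g^2(r)+f'(r)\bigl((m-g^2(r))\eta_w(r)-m\,h(r)\bigr)$. Let $\psi:D_R\to\mathbb R$, $\psi(x)=\psi(r(x))$, also denote its transplantation to $D_R$, and let $\psi^*:B^W_{T(R)}\to\mathbb R$ be the symmetrization of this transplanted function. Then $$\int_{D_R}\psi\,d\sigma=\int_{B^W_{T(R)}}\psi^*\,d\tilde\sigma .$$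
   Context: **Submanifold setting.** $N^n$ is a complete Riemannian manifold with a pole $p$, $r(x)=\operatorname{dist}_N(p,x)$; $P^m$ is an immersed complete submanifold, unbounded in $N$, with $p\in P$. The extrinsic ball $D_R$ is the connected component containing $p$ of $\{x\in P:r(x)<R\}$. $d\sigma$ and $d\tilde\sigma$ are the Riemannian volume elements of $P$ and of $M^m_W$. **Model spaces.** A $w$-model $M^m_w$ is the warped product with base an interval starting at $0$, fiber the unit sphere $S^{m-1}_1$, and smooth warping function $w$ with $w(0)=0$, $w'(0)=1$, $w(r)>0$ for $r>0$ (metric $dr^2+w(r)^2g_{S^{m-1}_1}$); its center point $p_w$ is at $r=0$. $\eta_w(r)=w'(r)/w(r)$. $B^w_r$ is the geodesic $r$-ball about $p_w$. **Isoperimetric comparison space.** Let $I=[0,R_0]$ ($0<R_0<\infty$) or $I=[0,\infty)$; let $w$ be a warping function on $I$, $h$ a smooth function on $I$, and $g$ a smooth function on $I$ with $0<g\le1$, $g(0)=1$. Let $s(r)=\int_0^r\frac{dt}{g(t)}$, with inverse $r(s)$. Let $\Lambda$ on $I$ satisfy $$\frac{d}{dr}\{\Lambda(r)w(r)g(r)\}=m\,\frac{\Lambda(r)}{g(r)}\bigl(w'(r)-h(r)w(r)\bigr),\qquad \frac{d}{dr}\Big|_{r=0}\Lambda^{\frac1{m-1}}(r)=1 .$$ Then $M^m_W=C^m_{w,g,h}$ is the model space with base $s(I)$, warping function $W(s)=\Lambda^{\frac1{m-1}}(r(s))$, and center $p_W$. **Symmetrization.** For a precompact set $D\subset P$, $D^*$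 is the ball in $M^m_W$ centered at $p_W$ with $\operatorname{Vol}(D^* )=\operatorname{Vol}(D)$. For a nonnegative function $f$ on $D$ and $t>0$ put $D(t)=\{x\in D: f(x)\ge t\}$; the symmetrization of $f$ is $f^*:D^*\to\mathbb R\cup\{0\}$, $f^*(x^* )=\sup\{t: x^*\in D(t)^*\}$. *)

(* Defs.v *)
From HB Require Import structures.
From mathcomp Require Import all_boot all_order all_algebra.
From mathcomp Require Import all_classical all_reals all_analysis.
Set Implicit Arguments.
Unset Strict Implicit.
Unset Printing Implicit Defensive.
Import Order.TTheory GRing.Theory Num.Theory.
Import numFieldNormedType.Exports.
Local Open Scope classical_set_scope.
Local Open Scope ring_scope.

(* Tangent vectors are row vectors; a metric is given in a chart by its Gram
   matrix G, and |v|^2 = v G v^T.  Since 'D_v f a = v *m jacobian f a, the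
   pull-back of G along f is J G J^T with J = jacobian f a. *)

(** * Calculus *)

(* C^k on an open subset A of a finite-dimensional space: all iterated
   directional derivatives up to order k exist and are continuous on A. *)
Fixpoint Ck (R : realType) (V W : normedModType R) (k : nat) (A : set V)
    (f : V -> W) : Prop :=
  (forall x, A x -> {for x, continuous f}) /\
  match k with
  | 0%N => True
  | k'.+1 => forall v, (forall x, A x -> derivable f x v) /\ Ck k' A ('D_v f)
  end.

Definition smooth (R : realType) (V W : normedModType R) (A : set V)
  (f : V -> W) : Prop := forall k, Ck k A f.

(* Derivatives relative to an interval I: one-sided at the end points that
   belong to I. *)
Definition is_derive_in (R : realType) (I : set R) (f : R -> R) (x l : R) :=
  (f y - f x) / (y - x) @[y --> within (I `\ x) (nbhs x)] --> l.

Definition derive_in (R : realType) (I : set R) (f : R -> R) (x : R) : R :=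
  lim ((f y - f x) / (y - x) @[y --> within (I `\ x) (nbhs x)]).

Definition smooth_in (R : realType) (I : set R) (f : R -> R) : Prop :=
  forall k x, I x -> exists l, is_derive_in I (iter k (derive_in I) f) x l.

(** * Lebesgue measure *)

Definition borel (T : topologicalType) := g_sigma_algebraType (@open T).

(* [lam] is the Lebesgue measure of R^m: the unique Borel measure giving every
   box the product of its side lengths. *)
Definition is_lebesgue (R : realType) (m : nat)
    (lam : {measure set (borel 'rV[R]_m) -> \bar R}) : Prop :=
  forall a b : 'rV[R]_m, (forall i, a 0 i <= b 0 i) ->
    lam [set x | forall i, a 0 i <= x 0 i <= b 0 i]
    = (\prod_i (b 0 i - a 0 i))%:E.

(** * Riemannian manifolds *)

Record manifold (R : realType) (n : nat) := Manifold {
  mpoint :> ptopologicalType;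
  chart : Type;
  dom : chart -> set mpoint;
  coord : chart -> mpoint -> 'rV[R]_n;
  param : chart -> 'rV[R]_n -> mpoint;
  chart_at : mpoint -> chart;
  manifold_hausdorff : hausdorff_space mpoint;
  manifold_second_countable : @second_countable mpoint;
  chart_atP : forall x, dom (chart_at x) x;
  open_dom : forall c, open (dom c);
  open_codom : forall c, open (coord c @` dom c);
  coordK : forall c x, dom c x -> param c (coord c x) = x;
  continuous_coord : forall c x, dom c x -> {for x, continuous (coord c)};
  continuous_param : forall c x, dom c x ->
    {for coord c x, continuous (param c)};
  smooth_transition : forall c d,
    smooth (coord c @` (dom c `&` dom d)) (coord d \o param c)
}.

Arguments param {R n _} _ _.
Arguments coord {R n _} _ _.
Arguments dom {R n _} _ _.
Arguments chart_at {R n _} _.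

Definition norm2 (R : realType) (n : nat) (G : 'M[R]_n) (v : 'rV[R]_n) : R :=
  (v *m G *m v^T) 0 0.

Record riemannian (R : realType) (n : nat) := Riemannian {
  riem_manifold :> manifold R n;
  gram : chart riem_manifold -> 'rV[R]_n -> 'M[R]_n;
  smooth_gram : forall c i j,
    smooth (coord c @` dom c) (fun y => gram c y i j);
  gram_sym : forall c x, dom c x -> (gram c (coord c x))^T = gram c (coord c x);
  gram_pos : forall c x, dom c x ->
    forall v, v != 0 -> 0 < norm2 (gram c (coord c x)) v;
  gram_transition : forall c d x, dom c x -> dom d x ->
    let J := jacobian (coord d \o param c) (coord c x) in
    gram c (coord c x) = J *m gram d (coord d x) *m J^T
}.

Arguments gram {R n _} _ _.

Definition Ck_curve (R : realType) (n : nat) (M : manifold R n) (k : nat)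
    (gam : R -> M) : Prop :=
  continuous gam /\
  forall c : chart M, Ck k (gam @^-1` dom c) (coord c \o gam).

Definition speed (R : realType) (n : nat) (M : riemannian R n) (gam : R -> M)
    (t : R) : R :=
  let c := chart_at (gam t) in
  Num.sqrt (norm2 (gram c (coord c (gam t))) (derive1 (coord c \o gam) t)).

(* [chain adm x y s]: the restrictions to [0,1] of the successive curves of s,
   all of them in adm, form a path from x to y.  With adm the C^1 curves these
   are the piecewise C^1 paths. *)
Fixpoint chain (R : realType) (T : Type) (adm : (R -> T) -> Prop) (x y : T)
    (s : seq (R -> T)) : Prop :=
  if s is gam :: s' then
    [/\ adm gam, gam 0 = x & chain adm (gam 1) y s']
  else x = y.

Definition path_dist (R : realType) (T : Type) (adm : (R -> T) -> Prop)
    (sp : (R -> T) -> R -> R) (x y : T) : \bar R :=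
  ereal_inf [set L | exists2 s, chain adm x y s &
    L = (\sum_(gam <- s)
           \int[@lebesgue_measure R]_(t in `[0%R, 1%R]) (sp gam t)%:E)%E].

Definition riem_dist (R : realType) (n : nat) (M : riemannian R n) (x y : M) :
    \bar R :=
  path_dist (@Ck_curve R n M 1) (@speed R n M) x y.

Definition complete (R : realType) (n : nat) (M : riemannian R n) : Prop :=
  forall u : nat -> M,
    (forall e : R, 0 < e -> exists k : nat, forall i j : nat,
       (k <= i)%N -> (k <= j)%N -> (riem_dist (u i) (u j) < e%:E)%E) ->
    exists x : M, u @ \oo --> x.

Definition christoffel (R : realType) (n : nat) (M : riemannian R n)
    (c : chart M) (y : 'rV[R]_n) (k i j : 'I_n) : R :=
  let dg l a b := 'D_(delta_mx 0 l) (fun z => gram c z a b) y in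
  2^-1 * \sum_l invmx (gram c y) k l * (dg i j l + dg j i l - dg l i j).

Definition geodesic (R : realType) (n : nat) (M : riemannian R n)
    (gam : R -> M) : Prop :=
  (forall k, Ck_curve k gam) /\
  forall (c : chart M) t, dom c (gam t) -> forall k : 'I_n,
    let u : R -> 'rV[R]_n := coord c \o gam in
    derive1n 2 u t 0 k
    + \sum_i \sum_j christoffel c (u t) k i j * derive1 u t 0 i * derive1 u t 0 j = 0.

(* p is a pole: exp_p is a diffeomorphism from T_p M onto M.  [E] is exp_p,
   T_p M being identified with R^n through the chart at p. *)
Definition pole (R : realType) (n : nat) (M : riemannian R n) (p : M) : Prop :=
  exists (E : 'rV[R]_n -> M) (F : M -> 'rV[R]_n),
    [/\ forall v, [/\ geodesic (fun t : R => E (t *: v)), E 0 = p &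
          derive1 (fun t : R => coord (chart_at p) (E (t *: v))) 0 = v],
        cancel E F, cancel F E,
        continuous E /\
          (forall c : chart M, smooth (E @^-1` dom c) (coord c \o E)) &
        forall c : chart M, smooth (coord c @` dom c) (F \o param c)].

(* The Riemannian volume measure, characterized by its expression
   sqrt(det G) dy in every chart. *)
Definition is_volume (R : realType) (m : nat)
    (lam : {measure set (borel 'rV[R]_m) -> \bar R}) (M : riemannian R m)
    (sigma : {measure set (borel M) -> \bar R}) : Prop :=
  forall (c : chart M) (A : set (borel M)), measurable A -> A `<=` dom c ->
    sigma A = (\int[lam]_(y in coord c @` A) (Num.sqrt (\det (gram c y)))%:E)%E.

(** * Immersed submanifolds and extrinsic balls *)

Definition immersion (R : realType) (m n : nat) (P : manifold R m)
    (N : manifold R n) (phi : P -> N) : Prop :=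
  continuous phi /\
  forall (c : chart P) (d : chart N),
    smooth (coord c @` (dom c `&` phi @^-1` dom d)) (coord d \o phi \o param c)
    /\ forall x, dom c x -> dom d (phi x) ->
         row_free (jacobian (coord d \o phi \o param c) (coord c x)).

Definition induced_metric (R : realType) (m n : nat) (P : riemannian R m)
    (N : riemannian R n) (phi : P -> N) : Prop :=
  forall (c : chart P) (d : chart N) x, dom c x -> dom d (phi x) ->
    let J := jacobian (coord d \o phi \o param c) (coord c x) in
    gram c (coord c x) = J *m gram d (coord d (phi x)) *m J^T.

Definition rdist (R : realType) (n : nat) (N : riemannian R n) (p x : N) : R :=
  fine (riem_dist p x).

Definition unbounded_in (R : realType) (m n : nat) (P : riemannian R m)
    (N : riemannian R n) (phi : P -> N) (p : N) : Prop :=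
  forall K : R, exists x : P, K < rdist p (phi x).

(* As phi need not be injective, o is the point of P lying over the pole p
   whose component is taken. *)
Definition extrinsic_ball (R : realType) (m n : nat) (P : riemannian R m)
    (N : riemannian R n) (phi : P -> N) (p : N) (o : P) (rad : R) : set P :=
  connected_component [set x | rdist p (phi x) < rad] o.

(** * Model spaces *)

Definition base_interval (R : realType) (I : set R) : Prop :=
  (exists2 R0 : R, 0 < R0 & I = `[0, R0]%classic) \/ I = `[0, +oo[%classic.

Definition warping (R : realType) (I : set R) (w : R -> R) : Prop :=
  [/\ smooth_in I w, w 0 = 0, derive_in I w 0 = 1 &
      forall r, I r -> 0 < r -> 0 < w r].

(* The model space with radial base interval [mbase] and warping function
   [mwarp], realized on the points x of R^m with |x| in mbase through
   x = s * theta (s = |x|, theta in the unit sphere); its center is 0. *)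
Record model (R : realType) := Model { mbase : set R; mwarp : R -> R }.

Definition enorm (R : realType) (m : nat) (x : 'rV[R]_m) : R :=
  Num.sqrt ((x *m x^T) 0 0).

Definition mset (R : realType) (m : nat) (X : model R) : set 'rV[R]_m :=
  [set x | mbase X (enorm x)].

(* ds^2 + W(s)^2 g_S in Cartesian coordinates: ds^2 has Gram matrix
   x^T x / |x|^2, and g_S has Gram matrix (1 - x^T x / |x|^2) / |x|^2. *)
Definition mgram (R : realType) (m : nat) (X : model R) (x : 'rV[R]_m) :
    'M[R]_m :=
  if x == 0 then 1%:M else
  let rad := (enorm x) ^- 2 *: (x^T *m x) in
  rad + (mwarp X (enorm x) / enorm x) ^+ 2 *: (1%:M - rad).

Definition mcurve (R : realType) (m : nat) (X : model R)
    (gam : R -> 'rV[R]_m) : Prop :=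
  Ck 1 setT gam /\ forall t, 0 <= t <= 1 -> mset X (gam t).

Definition mspeed (R : realType) (m : nat) (X : model R)
    (gam : R -> 'rV[R]_m) (t : R) : R :=
  Num.sqrt (norm2 (mgram X (gam t)) (derive1 gam t)).

Definition mdist (R : realType) (m : nat) (X : model R) (x y : 'rV[R]_m) :
    \bar R :=
  path_dist (mcurve X) (mspeed X) x y.

Definition mball (R : realType) (m : nat) (X : model R) (rho : R) :
    set 'rV[R]_m :=
  [set x | mset X x /\ (mdist X 0 x < rho%:E)%E].

Definition is_mvolume (R : realType) (m : nat)
    (lam : {measure set (borel 'rV[R]_m) -> \bar R}) (X : model R)
    (sigma : {measure set (borel 'rV[R]_m) -> \bar R}) : Prop :=
  forall A : set (borel 'rV[R]_m), measurable A -> A `<=` mset X ->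
    sigma A = (\int[lam]_(x in A) (Num.sqrt (\det (mgram X x)))%:E)%E.

(** * Isoperimetric comparison spaces *)

Definition stretch (R : realType) (g : R -> R) (r : R) : R :=
  \int[@lebesgue_measure R]_(t in `[0, r]) (g t)^-1.

Definition comparison_data (R : realType) (m : nat) (I : set R)
    (w g h Lam : R -> R) : Prop :=
  [/\ base_interval I,
      warping I w,
      smooth_in I h,
      [/\ smooth_in I g, forall r, I r -> 0 < g r <= 1 & g 0 = 1] &
      (forall r, I r ->
        is_derive_in I (fun x => Lam x * w x * g x) r
          (m%:R * (Lam r / g r) * (derive_in I w r - h r * w r))) /\
      is_derive_in I (fun r => Lam r `^ (m.-1%:R^-1)) 0 1].

Definition comparison_space (R : realType) (m : nat) (I : set R)
    (g Lam : R -> R) : model R :=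
  Model (stretch g @` I)
    (fun s => Lam ('pinv_(fun=> 0) I (stretch g) s) `^ (m.-1%:R^-1)).

(* The operator L, on functions f defined on the interval J; the derivative of
   w is taken in I. *)
Definition Lop (R : realType) (m : nat) (I : set R) (w g h : R -> R)
    (J : set R) (f : R -> R) (r : R) : R :=
  derive_in J (derive_in J f) r * g r ^+ 2
  + derive_in J f r
    * ((m%:R - g r ^+ 2) * (derive_in I w r / w r) - m%:R * h r).

(** * Schwarz symmetrization *)

Definition sym_set (R : realType) (m : nat) (P : riemannian R m)
    (sigma : {measure set (borel P) -> \bar R}) (X : model R)
    (sigmaX : {measure set (borel 'rV[R]_m) -> \bar R}) (D : set P) :
    set 'rV[R]_m :=
  mball X (xget 0 [set rho | mbase X rho /\ sigmaX (mball X rho) = sigma D]).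

Definition sym_fun (R : realType) (m : nat) (P : riemannian R m)
    (sigma : {measure set (borel P) -> \bar R}) (X : model R)
    (sigmaX : {measure set (borel 'rV[R]_m) -> \bar R}) (D : set P)
    (f : P -> R) (x : 'rV[R]_m) : R :=
  sup [set t | 0 < t /\ sym_set sigma X sigmaX [set y | D y /\ t <= f y] x].

(* Main.v *)
(* The function psi is nonnegative by the maximum principle.  The transplanted function and its
   symmetrization have superlevel sets of equal volume, hence equal integrals, as soon as every
   volume not exceeding that of D_R is attained by a geodesic ball about the center of M_W.  In the
   Cartesian model the geodesic s-ball is the Euclidean one, and the volume density with respect to
   Lebesgue measure is bounded above, and bounded below near the center; so the volume of the
   s-ball depends continuously on s, is positive for s > 0, and the intermediate value theorem
   applies.  On P the level sets are measurable because the distance to the pole is continuous and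
   D_R is open. *)

(* A ball of the comparison space is not determined here by its volume: the bounds keep the density
   away from 0 only near the center, so several radii may share one volume, and the radii that
   [xget] picks for different levels need not be ordered. For this reason only volumes are compared,
   never radii. Positivity of the volume of every ball of positive radius is still essential: it
   forces the radius of an empty level set to be nonpositive. Otherwise the set of levels under the
   supremum could be unbounded, and [sup] would then return 0. In Cartesian coordinates the density
   is [(W(s)/s)^(m-1)], so bounding it amounts to [W(s) <= C s]. Near the center this needs
   [Lam 0 = 0], which is not assumed and has to be extracted from the differential equation. Farther
   out, nothing is known of [Lam] directly, and it is controlled as the quotient of the continuous
   function [Lam w g] by [w g]. The lower bound near the center comes from the derivative 1 of the
   profile at 0. *)
Require Import Defs.
From HB Require Import structures.
From mathcomp Require Import all_boot all_order all_algebra.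
From mathcomp Require Import all_classical all_reals all_analysis.
From mathcomp Require Import measurable_realfun ring lra.
Set Implicit Arguments.
Unset Strict Implicit.
Unset Printing Implicit Defensive.
Import Order.TTheory GRing.Theory Num.Theory.
Import numFieldNormedType.Exports.
Local Open Scope classical_set_scope.
Local Open Scope ring_scope.

(** * Integrals and distribution functions *)

Section MeasureTheory.
Local Open Scope ereal_scope.

(* The integral of a nonnegative function is a supremum over the simple functions below it.  The
   speed of a curve and the volume density of a model space are not known to be measurable. *)
Lemma ge0_le_integral_nonmeasurable d (X : measurableType d) (R : realType)
    (mu : {measure set X -> \bar R}) (D : set X) (f1 f2 : X -> \bar R) :
  (forall x, D x -> 0 <= f1 x) -> (forall x, D x -> f1 x <= f2 x) ->
  \int[mu]_(x in D) f1 x <= \int[mu]_(x in D) f2 x.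
Proof.
move=> f0 f12; rewrite !ge0_integralE//; last first.
  by move=> x Dx; apply: le_trans (f0 _ Dx) (f12 _ Dx).
apply: ereal_sup_le => _ [k kf <-]; exists k => // x; apply: le_trans (kf x) _.
by apply: lee_restrict.
Qed.

Lemma integral_le_cst d (X : measurableType d) (R : realType)
    (mu : {measure set X -> \bar R}) (D : set X) (f : X -> \bar R) (c : R) :
  measurable D -> (forall x, D x -> 0 <= f x) -> (forall x, D x -> f x <= c%:E) ->
  \int[mu]_(x in D) f x <= c%:E * mu D.
Proof.
move=> mD f0 fc; rewrite -integral_cst//; exact: ge0_le_integral_nonmeasurable.
Qed.

Lemma integral_ge_cst d (X : measurableType d) (R : realType)
    (mu : {measure set X -> \bar R}) (D : set X) (f : X -> \bar R) (c : R) :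
  measurable D -> (0 <= c)%R -> (forall x, D x -> c%:E <= f x) ->
  c%:E * mu D <= \int[mu]_(x in D) f x.
Proof.
move=> mD c0 fc; rewrite -integral_cst//; exact: ge0_le_integral_nonmeasurable.
Qed.

Lemma measurable_fun_gt d (X : measurableType d) (R : realType) (D : set X)
    (f : X -> R) :
  (forall t, measurable (D `&` [set x | (t < f x)%R])) -> measurable_fun D f.
Proof.
move=> mf mD; apply: (measurability _ (RGenOInfty.measurableE R)) => //.
move=> _ [_ [t ->] <-]; rewrite [X in measurable X](_ : _ = D `&` [set x | (t < f x)%R]); first exact: mf.
by apply/seteqP; split => x /= [Dx]; rewrite in_itv/= andbT.
Qed.

(** An image measure carries its measure structure only together with a proof of measurability; the
    existential packs both, as [mrestr] and [measure_unique] require. *)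
Lemma pushforward_is_measure d d' (X : measurableType d) (Y : measurableType d')
    (R : realType) (mu : {measure set X -> \bar R}) (f : X -> Y) :
  measurable_fun setT f ->
  exists p : {measure set Y -> \bar R}, p = pushforward mu f :> (set Y -> \bar R).
Proof. by move=> mf; unshelve (eexists (pushforward mu f)). Qed.

(** Both integrals become the integral of the identity over []0, +oo[] against the image measures of
    [f] and [g], extended by 0. The value 0 is cut off because the complement of [D] may have
    infinite mass. What remains is determined by its values on the rays []t, +oo[], finite because
    [mu D] is. *)
Lemma eq_integral_distribution d d' (X : measurableType d) (Y : measurableType d')
    (R : realType) (mu : {measure set X -> \bar R}) (nu : {measure set Y -> \bar R})
    (D : set X) (E : set Y) (f : X -> R) (g : Y -> R) :
  measurable D -> measurable E -> measurable_fun D f -> measurable_fun E g ->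
  (forall x, D x -> 0 <= f x)%R -> (forall y, E y -> 0 <= g y)%R ->
  (mu D < +oo) ->
  (forall t : R, (0 <= t)%R -> mu (D `&` [set x | t < f x]%R) = nu (E `&` [set y | t < g y]%R)) ->
  \int[mu]_(x in D) (f x)%:E = \int[nu]_(y in E) (g y)%:E.
Proof.
move=> mD mE mf mg f0 g0 Doo fg.
have pos d1 (Z : measurableType d1) (m : {measure set Z -> \bar R}) (F : set Z) (k : Z -> R) :
    measurable F -> measurable_fun F k -> (forall x, F x -> 0 <= k x)%R ->
    measurable_fun setT (k \_ F)%R /\
    \int[m]_(x in F) (k x)%:E =
    \int[pushforward m (k \_ F)%R]_(y in `]0%R, +oo[) y%:E.
  move=> mF mk k0; have mkF : measurable_fun setT (k \_ F)%R by apply/(measurable_restrictT _ mF).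
  split=> //.
  rewrite [RHS]ge0_integral_pushforward//; last first.
    by move=> y /set_mem/=; rewrite in_itv/= andbT lee_fin => /ltW.
  rewrite integral_mkcond [RHS]integral_mkcond; apply: eq_integral => x _.
  rewrite /patch/=; case: (boolP (x \in F)) => xF.
    case: ifPn => //; rewrite notin_setE/= in_itv/= xF andbT => /negP.
    rewrite -leNgt => k00; congr EFin.
    by apply/eqP; rewrite eq_le k00 k0//; rewrite inE in xF.
  by case: ifPn => //; rewrite inE/= in_itv/= (negbTE xF) ltxx.
have [mF ->] := pos _ _ mu D f mD mf f0.
have [mG ->] := pos _ _ nu E g mE mg g0.
apply: eq_measure_integral => A mA A0.
have m0 : measurable (`]0%R, +oo[%classic : set R) by exact: measurable_itv.
have [p1 p1E] := pushforward_is_measure mu mF.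
have [p2 p2E] := pushforward_is_measure nu mG.
suff : mrestr p1 m0 A = mrestr p2 m0 A.
  by rewrite /mrestr/= !setIidl// p1E p2E.
(* The threshold is [max t 0] because of the restriction to []0, +oo[]; it also discards the points
   outside [F], where the extension is 0. *)
have lev d1 (Z : measurableType d1) (F : set Z) (k : Z -> R) (t : R) :
    (k \_ F)%R @^-1` (`]t, +oo[ `&` `]0%R, +oo[)%classic = F `&` [set x | Num.max t 0 < k x]%R.
  apply/seteqP; split => x /=; rewrite /patch !in_itv/= !andbT gt_max.
    by move=> []; case: ifPn => [/[1!inE]//|_]; rewrite ?ltxx// => ? -> ->.
  by move=> [Fx /andP[tk k0]]; rewrite ifT ?mem_set.
have lev1 t : mrestr p1 m0 `]t, +oo[%classic = mu (D `&` [set x | Num.max t 0 < f x]%R).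
  by rewrite /mrestr/= p1E /pushforward; congr (mu _); exact: lev.
have lev2 t : mrestr p2 m0 `]t, +oo[%classic = nu (E `&` [set x | Num.max t 0 < g x]%R).
  by rewrite /mrestr/= p2E /pushforward; congr (nu _); exact: lev.
apply: (@measure_unique _ R _ (@RGenOInfty.G R)
  (fun k => `](- k%:R)%R, +oo[%classic) _ _ _ _ (mrestr p1 m0) (mrestr p2 m0)).
- exact: RGenOInfty.measurableE.
- move=> _ _ [x ->] [y ->]; exists (Num.max x y).
  apply/seteqP; split => z /=; rewrite !in_itv/= !andbT gt_max.
    by move=> [-> ->].
  by move=> /andP[].
- by move=> k; exists (- k%:R)%R.
- apply/seteqP; split => // x _; exists (Num.bound `|x|)%R => //=.
  rewrite in_itv/= andbT ltrNl (le_lt_trans _ (archi_boundP _))//.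
  by rewrite -normrN ler_norm.
- move=> _ [t ->]; apply: etrans (lev1 t) (etrans _ (esym (lev2 t))); apply: fg.
  by rewrite le_max lexx orbT.
- move=> k; apply: le_lt_trans Doo.
  apply: (@le_trans _ _ (mu (D `&` [set x | Num.max (- k%:R) 0 < f x]%R))).
    by rewrite le_eqVlt; apply/orP; left; apply/eqP; exact: lev1.
  apply: le_measure; rewrite ?inE; [|exact: mD|exact: subIsetl].
  rewrite -lev -[X in measurable X]setTI; apply: mF => //.
  by apply: measurableI.
- exact: mA.
Qed.

End MeasureTheory.
(** Continuity from below; it serves to replace strict level sets and open balls by increasing
    unions for which the volumes are known. *)
Lemma bigcup_le_measure d (X : measurableType d) (R : realType)
    (mu : {measure set X -> \bar R}) (F : (set X)^nat) (c : \bar R) :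
  (forall i, measurable (F i)) -> {homo F : i j / (i <= j)%N >-> i `<=` j} ->
  (forall i, (mu (F i) <= c)%E) -> (mu (\bigcup_i F i) <= c)%E.
Proof.
move=> mF homF Fc.
have cv : (mu \o F) x @[x --> \oo] --> mu (\bigcup_i F i).
  apply: nondecreasing_cvg_mu => //; first exact: bigcup_measurable.
  by move=> i j ij; apply/subsetPset; exact: homF.
by rewrite -(cvg_lim _ cv)//; apply: lime_le; [apply/cvg_ex; eexists; exact: cv|exact: nearW].
Qed.

(* The superlevel set of the supremum above the level [tau] is the ball of radius
   [sup (rho t), t > tau]; the [rho t] need not be monotone, but their volumes are. *)
Lemma integral_symmetrization d d' (X : measurableType d) (Y : measurableType d')
    (R : realType) (mu : {measure set X -> \bar R}) (nu : {measure set Y -> \bar R})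
    (D : set X) (F : X -> R) (M : R) (N : Y -> R) (T : R) (rho : R -> R) :
  measurable D -> measurable_fun D F -> (forall x, D x -> 0 <= F x <= M) ->
  (forall y, 0 <= N y) -> (forall r, measurable [set y | N y < r]) ->
  (mu D < +oo)%E -> nu [set y | N y < T] = mu D ->
  (forall t : R, 0 < t -> nu [set y | N y < rho t] = mu (D `&` [set x | t <= F x])) ->
  (forall t, M < t -> rho t <= 0) ->
  (\int[mu]_(x in D) (F x)%:E =
   \int[nu]_(y in [set y | N y < T]%R) (sup [set t : R | (0 < t)%R /\ (N y < rho t)%R])%:E)%E.
Proof.
move=> mD mF F0M N0 mN Doo nuT nurho rhoM.
set E := [set y | N y < T].
pose A y := [set t : R | 0 < t /\ N y < rho t].
have AM y t : A y t -> t <= M.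
  by move=> [_ Nt]; rewrite leNgt; apply/negP => /rhoM; rewrite leNgt (le_lt_trans (N0 y) Nt).
have hA y t : A y t -> has_sup (A y).
  by move=> At; split; [exists t|exists M => s /AM].
have A0 y : 0 <= sup (A y).
  have [/set0P[t At]|] := boolP (A y != set0); last first.
    by rewrite negbK => /eqP ->; rewrite sup0.
  by apply: (@le_trans _ _ t); [case: At => /ltW|apply: ub_le_sup (At); case: (hA _ _ At)].
(* Cutting the radii at [T] builds the intersection with [E] into the supremum and bounds the set
   from above. *)
pose S tau := [set Num.min T (rho t) | t in [set t | tau < t]].
have hS tau : has_sup (S tau).
  split; first by exists (Num.min T (rho (tau + 1))); exists (tau + 1); rewrite //= ltrDl.
  by exists T => _ [t _ <-]; rewrite ge_min lexx.
have lev (tau : R) : 0 <= tau -> E `&` [set y | tau < sup (A y)] = [set y | N y < sup (S tau)].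
  move=> tau0; apply/seteqP; split => y /=.
    move=> [NT tA].
    (* [sup] is 0 on a set without supremum, which [tau < sup (A y)] and [0 <= tau] exclude. *)
    have hy : has_sup (A y).
      have [//|h] := pselect (has_sup (A y)).
      by move: tA; rewrite sup_out// ltNge tau0.
    have [t At tt] := sup_gt (hy.1) tA.
    apply: (@lt_le_trans _ _ (Num.min T (rho t))); first by rewrite lt_min NT; case: At.
    by apply: ub_le_sup; [case: (hS tau)|exists t].
  move=> /(sup_gt (hS tau).1)[_ [t tt <-]]; rewrite lt_min => /andP[NT Nr]; split=> //.
  have At : A y t by split => //; exact: le_lt_trans tt.
  by apply: lt_le_trans tt _; apply: ub_le_sup (At); case: (hA _ _ At).
have mE : measurable E by exact: mN.
have mFs s : measurable (D `&` [set x | s <= F x]).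
  rewrite [X in measurable X](_ : _ = D `&` F @^-1` `[s, +oo[%classic).
    by apply: mF => //; exact: measurable_itv.
  by apply/seteqP; split => x /=; rewrite in_itv/= andbT.
have mFs' s : measurable (D `&` [set x | s < F x]).
  rewrite [X in measurable X](_ : _ = D `&` F @^-1` `]s, +oo[%classic).
    by apply: mF => //; exact: measurable_itv.
  by apply/seteqP; split => x /=; rewrite in_itv/= andbT.
apply: eq_integral_distribution => //.
- apply: measurable_fun_gt => t; have [t0|t0] := leP 0 t; first by rewrite lev.
  rewrite [X in measurable X](_ : _ = E)//; apply/seteqP; split => [y []//|y Ey].
  by split=> //=; exact: lt_le_trans (A0 y).
- by move=> x /F0M /andP[].
- by move=> y _; exact: A0.
- move=> tau tau0.
  transitivity (nu [set y | N y < sup (S tau)]); last by congr (nu _); exact/esym/lev.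
  apply/eqP; rewrite eq_le; apply/andP; split.
    (* The level sets at [tau + 1/(n+1)] increase to the strict one, and each has the volume of the
       ball of the corresponding radius. If that radius exceeds [T], the cut radius is [T], and the
       volume of [E], equal to that of [D], suffices. *)
    rewrite [X in mu X](_ : _ = \bigcup_n (D `&` [set x | tau + n.+1%:R^-1 <= F x])); last first.
      apply/seteqP; split => x /=; last first.
        by move=> [n _ [Dx h]]; split => //; apply: lt_le_trans h; rewrite ltrDl.
      move=> [Dx tx]; have : 0 < F x - tau by rewrite subr_gt0.
      move=> /ltr_add_invr[n]; rewrite add0r => h; exists n => //; split => //=.
      by rewrite addrC -lerBrDr ltW.
    apply: bigcup_le_measure => // [i j ij x [Dx h]|i].
      by split => //=; apply: le_trans h; rewrite /= lerD2l lef_pV2 ?posrE// ler_nat ltnS.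
    rewrite -nurho; last by rewrite ltr_wpDl.
    have [rT|Tr] := leP (rho (tau + i.+1%:R^-1)) T.
      apply: le_measure; rewrite ?inE// => y /= /lt_le_trans; apply.
      apply: ub_le_sup; first by case: (hS tau).
      by exists (tau + i.+1%:R^-1); rewrite /= ?ltrDl// (min_idPr rT).
    rewrite nurho; last by rewrite ltr_wpDl.
    apply: (@le_trans _ _ (mu D)); first by apply: le_measure; rewrite ?inE//; exact: subIsetl.
    rewrite -nuT; apply: le_measure; rewrite ?inE// => y /= /lt_le_trans; apply.
    apply: ub_le_sup; first by case: (hS tau).
    by exists (tau + i.+1%:R^-1); rewrite /= ?ltrDl// (min_idPl (ltW Tr)).
  (* Conversely, each slightly smaller ball lies in a ball of radius [rho t] with [tau < t], whose
     volume is that of a level set contained in the strict one at [tau]. *)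
  rewrite [X in nu X](_ : _ = \bigcup_n [set y | N y < sup (S tau) - n.+1%:R^-1]); last first.
    apply/seteqP; split => y /=; last first.
      by move=> [n _ /= /lt_le_trans]; apply; rewrite gerBl.
    rewrite -subr_gt0 => /ltr_add_invr[n]; rewrite add0r => h; exists n => //=.
    by rewrite ltrBrDr -ltrBrDl.
  apply: bigcup_le_measure => // [i j ij y /= /lt_le_trans|i].
    by apply; rewrite lerD2l lerN2 lef_pV2 ?posrE// ler_nat ltnS.
  have /(sup_gt (hS tau).1) [_ [t tt <-] h] : sup (S tau) - i.+1%:R^-1 < sup (S tau).
    by rewrite gtrBl.
  have t0 : 0 < t by exact: le_lt_trans tt.
  apply: (@le_trans _ _ (nu [set y | N y < rho t])).
    apply: le_measure; rewrite ?inE// => y /= /lt_trans /(_ h).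
    by rewrite lt_min => /andP[].
  rewrite nurho//; apply: le_measure; rewrite ?inE// => x [Dx /= h']; split => //=.
  exact: lt_le_trans h'.
Qed.
(** * Differentiability of C^1 maps *)

Lemma coord_le_norm (R : realType) (m : nat) (v : 'rV[R]_m) (i : 'I_m) : `|v 0 i| <= `|v|.
Proof. by rewrite [leRHS]/Num.Def.normr/= mx_normrE; exact: (le_bigmax _ _ (0, i)). Qed.

Lemma norm_rV_lt (R : realType) (m : nat) (v : 'rV[R]_m) (e : R) :
  0 < e -> (forall i, `|v 0 i| < e) -> `|v| < e.
Proof.
move=> e0 ve; rewrite [ltLHS]/Num.Def.normr/= mx_normrE; apply: bigmax_lt => // -[i j] _ /=.
by rewrite (ord1 i).
Qed.

Lemma is_derive_line (R : realType) (V W : normedModType R) (f : V -> W) (y v : V) (u : R) :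
  derivable f (y + u *: v) v ->
  is_derive u 1 (fun t : R => f (y + t *: v)) ('D_v f (y + u *: v)).
Proof.
move=> df.
have E : (fun h : R => h^-1 *: ((f \o shift (y + u *: v)) (h *: v) - f (y + u *: v))) =
   (fun h : R => h^-1 *: (((fun t : R => f (y + t *: v)) \o shift u) (h *: (1 : R)) - f (y + u *: v))).
  apply/funext => h /=; congr (_ *: (f _ - _)).
  by rewrite [h *: 1]mulr1 scalerDl addrCA.
by apply: DeriveDef; [rewrite /derivable -E|rewrite /derive -E].
Qed.

(** Mean value theorem along the segment, reparametrized by [[0, 1]] so that the sign of [s] does
    not matter. *)
Lemma line_increment (R : realType) (V : normedModType R) (f : V -> R) (y v : V) (s c e : R) :
  (forall t : R, 0 <= t <= 1 -> derivable f (y + (t * s) *: v) v /\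
    `|'D_v f (y + (t * s) *: v) - c| <= e) ->
  `|f (y + s *: v) - f y - s * c| <= e * `|s|.
Proof.
move=> df; pose phi (t : R) := f (y + (t * s) *: v).
have dphi (t : R) : 0 <= t <= 1 -> is_derive t (1 : R) phi ('D_v f (y + (t * s) *: v) * s).
  move=> /df[+ _] => /is_derive_line d1.
  apply: (@is_derive1_comp _ (fun u => f (y + u *: v)) (fun t => t * s)).
  have -> : *%R^~ s = (s \*: id)%R :> (R -> R) by apply/funext => z; rewrite /= mulrC.
  by apply: is_derive_eq; rewrite [LHS]mulr1.
have [t] : exists2 t, t \in `[0, 1] & phi 1 - phi 0 = 'D_v f (y + (t * s) *: v) * s * (1 - 0).
  apply: (@MVT_segment _ phi (fun t => 'D_v f (y + (t * s) *: v) * s)) => //.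
    by move=> t /[!in_itv]/= /andP[t0 t1]; apply: dphi; rewrite !ltW.
  apply: derivable_within_continuous => t; rewrite in_itv/= => /dphi d.
  exact: ex_derive.
rewrite in_itv/= /phi mul1r mul0r scale0r addr0 subr0 mulr1 => /df[_ h] ->.
by rewrite mulrC -mulrBr normrM mulrC ler_wpM2r.
Qed.

(** The point moves from [a] to [a + h] one coordinate at a time, [p k] keeping the first [k]
    coordinates of [h]. For the sup norm no intermediate point is farther from [a] than [a + h]. *)
Lemma row_increment (R : realType) (n : nat) (f : 'rV[R]_n -> R) (a h : 'rV[R]_n) (r e : R) :
  (forall y, `|y - a| < r -> forall i, derivable f y (delta_mx 0 i) /\
     `|'D_(delta_mx 0 i) f y - 'D_(delta_mx 0 i) f a| <= e) ->
  `|h| < r ->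
  `|f (a + h) - f a - \sum_i h 0 i * 'D_(delta_mx 0 i) f a| <= e * \sum_i `|h 0 i|.
Proof.
move=> df hr; pose p (k : nat) : 'rV[R]_n := \row_l (if (l < k)%N then h 0 l else 0).
have pn : p n = h by apply/rowP => i; rewrite mxE ltn_ord.
have p0 : p 0%N = 0 by apply/rowP => i; rewrite !mxE.
have pS (k : 'I_n) : p k.+1 = p k + h 0 k *: delta_mx 0 k.
  apply/rowP => i; rewrite !mxE eqxx/= ltnS; have [->|ik] := eqVneq i k.
    by rewrite leqnn ltnn add0r mulr1.
  by rewrite mulr0 addr0 leq_eqVlt (inj_eq val_inj) (negbTE ik).
have -> : f (a + h) - f a = \sum_(k < n) (f (a + p k.+1) - f (a + p k)).
  rewrite -(big_mkord xpredT (fun k => f (a + p k.+1) - f (a + p k))).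
  by rewrite (telescope_sumr (fun k => f (a + p k)))// pn p0 addr0.
rewrite -sumrB mulr_sumr (le_trans (ler_norm_sum _ _ _))//; apply: ler_sum => k _.
rewrite pS addrA; apply: line_increment => t /andP[t0 t1]; apply: df.
apply: le_lt_trans hr; rewrite -(addrA a) [a + _]addrC addrK.
rewrite [leLHS]/Num.Def.normr/= mx_normrE; apply: bigmax_le => // -[i j] _ /=.
apply: (@le_trans _ _ `|h i j|); last first.
  by rewrite (ord1 i); exact: coord_le_norm.
rewrite !mxE (ord1 i) eqxx/=; have [->|jk] := eqVneq j k.
  by rewrite ltnn add0r mulr1 normrM ler_piMl// ger0_norm.
by rewrite mulr0 addr0; case: ifPn; rewrite ?normr0.
Qed.

Lemma mulmxr_continuous (R : realType) (n k : nat) (M : 'M[R]_(n, k)) :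
  continuous (mulmxr M : 'rV[R]_n -> 'rV[R]_k).
Proof.
apply: bounded_linear_continuous; apply/linear_boundedP.
have C0 : 0 <= \sum_i \sum_j `|M i j| by rewrite sumr_ge0// => i _; rewrite sumr_ge0.
near=> C; move=> h.
have hC : \sum_i \sum_j `|M i j| <= C by near: C; apply: nbhs_pinfty_ge; exact: num_real.
rewrite [leLHS]/Num.Def.normr/= mx_normrE; apply: bigmax_le.
  by rewrite mulr_ge0// (le_trans C0).
move=> [i j] _ /=; rewrite mxE (le_trans (ler_norm_sum _ _ _))//.
apply: (@le_trans _ _ ((\sum_i \sum_j `|M i j|) * `|h|)); last by rewrite ler_wpM2r.
rewrite mulr_suml; apply: ler_sum => l _; rewrite normrM mulrC ler_pM//.
  by rewrite (bigD1 j)//= lerDl sumr_ge0.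
rewrite (ord1 i); exact: coord_le_norm.
Unshelve. all: by end_near. Qed.

Lemma linear_approx_differentiable (R : realType) (V W : normedModType R) (f : V -> W)
    (df : {linear V -> W}) (a : V) : continuous df ->
  (forall e : R, 0 < e ->
    \forall h \near (0 : V), `|f (h + a) - f a - df h| <= e * `|h|) ->
  differentiable f a.
Proof.
move=> dfc fe.
have exp : f \o shift a = cst (f a) + df +o_ 0 id.
  apply/eqaddoP => e e0; near=> h => /=; rewrite opprD addrA.
  by near: h; exact: fe.
by apply/diff_locallyP; rewrite (diff_unique dfc exp).
Unshelve. all: by end_near. Qed.

(** [Ck] speaks of directional derivatives only, whereas the change of chart for Gram matrices uses
    the Jacobian, hence the full differential. *)
Lemma C1_differentiable (R : realType) (n k : nat) (A : set 'rV[R]_n)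
    (f : 'rV[R]_n -> 'rV[R]_k) (a : 'rV[R]_n) :
  open A -> Ck 1 A f -> A a -> differentiable f a.
Proof.
move=> oA [_ C1] Aa.
pose M : 'M[R]_(n, k) := \matrix_(i, j) 'D_(delta_mx 0 i) f a 0 j.
pose df : {linear 'rV[R]_n -> 'rV[R]_k} := mulmxr M.
have dfc : continuous df by exact: mulmxr_continuous.
apply: (linear_approx_differentiable dfc) => e e0.
(* The errors of [n] coordinate steps add up; [n.+1] keeps the denominator nonzero when [n] is 0. *)
pose e' := e / n.+1%:R; have e'0 : 0 < e' by rewrite divr_gt0.
have N : \forall y \near a, A y /\
    forall i : 'I_n, `|'D_(delta_mx 0 i) f y - 'D_(delta_mx 0 i) f a| <= e'.
  apply: filterI; first exact: open_nbhs_nbhs.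
  apply: (@filter_forall _ _
      (fun (i : 'I_n) y => `|'D_(delta_mx 0 i) f y - 'D_(delta_mx 0 i) f a| <= e') (nbhs a)) => i.
  have [_ [/(_ a Aa) + _]] := C1 (delta_mx 0 i).
  by move=> /cvgrPdist_le /(_ _ e'0); apply: filterS => y; rewrite distrC.
have /nbhs_ballP[r /= r0 rN] := N.
have B : \forall h \near (0 : 'rV[R]_n), `|h| < r by exact: nbhs0_lt.
near=> h.
have hr : `|h| < r by near: h.
rewrite [leLHS]/Num.Def.normr/= mx_normrE; apply: bigmax_le; first by rewrite mulr_ge0// ltW.
move=> [i j] _ /=; rewrite (ord1 i) !mxE.
have comp y l : A y -> derivable (fun y => f y 0 j) y (delta_mx 0 l) /\
   'D_(delta_mx 0 l) (fun y => f y 0 j) y = 'D_(delta_mx 0 l) f y 0 j.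
  move=> Ay; have [/(_ _ Ay) d _] := C1 (delta_mx 0 l).
  split; first by move/derivable_mxP : d => /(_ 0 j).
  by rewrite derive_mx// mxE.
have H y : `|y - a| < r -> forall l : 'I_n, derivable (fun y => f y 0 j) y (delta_mx 0 l) /\
    `|'D_(delta_mx 0 l) (fun y => f y 0 j) y - 'D_(delta_mx 0 l) (fun y => f y 0 j) a| <= e'.
  move=> yr l; have [|Ay /(_ l) Dy] := rN y; first by rewrite -ball_normE /= distrC.
  have [d1 ->] := comp y l Ay; split => //; rewrite (comp a l Aa).2.
  by apply: le_trans Dy; apply: le_trans (coord_le_norm _ j); rewrite !mxE.
have := row_increment H hr; rewrite [a + h]addrC /=.
under [X in _ - X]eq_bigr do rewrite (comp _ _ Aa).2.
have -> : \sum_(l < n) h 0 l * ('D_(delta_mx 0 l) f a) 0 j = \sum_(l < n) h 0 l * M l j.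
  by apply: eq_bigr => l _; rewrite mxE.
move=> /le_trans; apply.
rewrite /e' mulrAC ler_pdivrMr// -mulrA ler_pM2l//.
apply: (@le_trans _ _ (\sum_(l < n) `|h|)).
  by apply: ler_sum => l _; exact: coord_le_norm.
by rewrite mulr_natr sumr_const card_ord mulrSr lerDl.
Unshelve. all: by end_near. Qed.
(** * The Riemannian distance *)

(* The name [coord] is shadowed by the coordinate functions of vector.v. *)
Local Notation coord := Defs.coord.

Lemma is_derive_comp_vector (R : realType) (W : normedModType R) (G : R -> W) (th : R -> R)
    (t dth : R) (dG : W) :
  is_derive (th t) 1 G dG -> is_derive t 1 th dth ->
  is_derive t 1 (G \o th) (dth *: dG).
Proof.
move=> [/derivable1_diffP dG1 <-] [/derivable1_diffP dth1 <-].
apply: DeriveDef; first exact/derivable1_diffP/differentiable_comp.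
rewrite deriveE; last exact: differentiable_comp.
rewrite diff_comp//= deriveE// deriveE//.
by rewrite -[in LHS](mulr1 ('d th t 1)) -[LHS]/('d G (th t) ('d th t 1 *: (1 : R))) linearZ.
Qed.

Lemma open_chart_overlap (R : realType) (n : nat) (M : manifold R n) (c d : chart M) :
  open (coord c @` (dom c `&` dom d)).
Proof.
rewrite openE => _ [x [cx dx] <-].
have N1 : nbhs (coord c x) (coord c @` dom c).
  by apply: open_nbhs_nbhs; split; [exact: open_codom|exists x].
have N2 : nbhs (coord c x) (param c @^-1` dom d).
  apply: continuous_param => //; rewrite coordK//.
  by apply: open_nbhs_nbhs; split => //; exact: open_dom.
apply: filterS (filterI N1 N2) => _ [[x' cx' <-]] /=; rewrite coordK// => dx'.
by exists x'.
Qed.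

Lemma Ck_near_continuous (R : realType) (V W : normedModType R) (f g : V -> W) (x : V) :
  (\forall y \near x, f y = g y) -> {for x, continuous g} -> {for x, continuous f}.
Proof.
move=> fg cg; rewrite /prop_for /continuous_at (nbhs_singleton fg).
by apply: cvg_trans cg; apply: near_eq_cvg; apply: filterS fg => y ->.
Qed.

(** The parameter [th] is left abstract, so that one computation serves both directions along a
    chart segment. *)
Lemma chart_segment_derive (R : realType) (n : nat) (M : manifold R n) (c d : chart M)
    (x0 v : 'rV[R]_n) (th dth : R -> R) :
  (forall t : R, is_derive t 1 th (dth t)) ->
  (forall t, (coord c @` dom c) (x0 + th t *: v)) ->
  forall t, dom d (param c (x0 + th t *: v)) ->
  is_derive t (1 : R) (coord d \o (fun t => param c (x0 + th t *: v)))
    (dth t *: 'D_v (coord d \o param c) (x0 + th t *: v)).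
Proof.
move=> dthE U t dt.
have Ot : (coord c @` (dom c `&` dom d)) (x0 + th t *: v).
  have [x cx E] := U t; exists x => //; split => //.
  by rewrite -E coordK// in dt.
have [_ /(_ v)[/(_ _ Ot) dF _]] := smooth_transition c d 1%N.
exact: (is_derive_comp_vector (is_derive_line dF) (dthE t)).
Qed.

Lemma chart_segment_Ck (R : realType) (n : nat) (M : manifold R n) (c : chart M)
    (x0 v : 'rV[R]_n) (th dth : R -> R) :
  (forall t : R, is_derive t 1 th (dth t)) -> continuous dth ->
  (forall t, (coord c @` dom c) (x0 + th t *: v)) ->
  Ck_curve 1 (fun t => param c (x0 + th t *: v)).
Proof.
move=> dthE cdth U.
have cth t : {for t, continuous th}.
  by apply/differentiable_continuous/derivable1_diffP; case: (dthE t).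
have cu t : {for t, continuous (fun t => x0 + th t *: v)}.
  by apply: cvgD; [exact: cvg_cst|apply: cvgZr_tmp; exact: cth].
have cgam : continuous (fun t => param c (x0 + th t *: v)).
  move=> t; apply: (@continuous_comp _ _ _ (fun t => x0 + th t *: v) (param c)); first exact: cu.
  by have [x cx <-] := U t; exact: continuous_param.
split=> // d; set gam := (fun t => param c _).
have D t : dom d (gam t) -> is_derive t (1 : R) (coord d \o gam)
    (dth t *: 'D_v (coord d \o param c) (x0 + th t *: v)).
  by move=> dt; exact: chart_segment_derive.
have og : open (gam @^-1` dom d).
  by apply: open_comp => [t _|]; [exact: cgam|exact: open_dom].
have diffg t : dom d (gam t) -> differentiable (coord d \o gam) t.
  by move=> /D[/derivable1_diffP].
have Ot t : dom d (gam t) -> (coord c @` (dom c `&` dom d)) (x0 + th t *: v).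
  move=> dt; have [x cx E] := U t; exists x => //; split => //.
  by rewrite /gam -E coordK// in dt.
split; first by move=> t dt; apply/differentiable_continuous; exact: diffg.
move=> r; split; first by move=> t /diffg; exact: diff_derivable.
split=> // t dt.
apply: (@Ck_near_continuous _ _ _ _ (fun t => (r * dth t) *: 'D_v (coord d \o param c) (x0 + th t *: v))).
  have : nbhs t (gam @^-1` dom d) by apply: open_nbhs_nbhs; split.
  apply: filterS => s ds; rewrite deriveE; last exact: diffg.
  rewrite -(mulr1 r) -[LHS]/('d (coord d \o gam) s (r *: (1 : R))) linearZ mulr1 -scalerA.
  have [_ <-] := D s ds; rewrite -deriveE//; exact: diffg.
have [_ /(_ v)[_ [cF _]]] := smooth_transition c d 1%N.
have c2 := @continuous_comp _ _ _ (fun t => x0 + th t *: v) ('D_v (coord d \o param c))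
  t (cu t) (cF _ (Ot _ dt)).
have c1 : (r * dth s) @[s --> t] --> r * dth t.
  by apply: cvgM; [exact: cvg_cst|exact: cdth].
exact: (cvgZ c1 c2).
Qed.

(** [speed] reads the metric in a chart that varies with the point; the transformation rule of
    [gram] brings it back to the fixed chart [c], where it can be bounded uniformly. *)
Lemma chart_segment_speed (R : realType) (n : nat) (M : riemannian R n) (c : chart M)
    (x0 v : 'rV[R]_n) (th dth : R -> R) :
  (forall t : R, is_derive t 1 th (dth t)) ->
  (forall t, (coord c @` dom c) (x0 + th t *: v)) ->
  forall t, speed (fun t => param c (x0 + th t *: v)) t =
    Num.sqrt (norm2 (gram c (x0 + th t *: v)) (dth t *: v)).
Proof.
move=> dthE U t; rewrite /speed; set gam := fun t => param c _; set d := chart_at _.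
have dt : dom d (gam t) by exact: chart_atP.
have [x cx E] := U t.
have gx : gam t = x by rewrite /gam -E coordK.
have C1 := @smooth_transition _ _ M c d 1%N.
have Ot : (coord c @` (dom c `&` dom d)) (x0 + th t *: v).
  by exists x => //; split => //; rewrite -gx.
have dF : differentiable (coord d \o param c) (x0 + th t *: v).
  by apply: C1_differentiable C1 Ot; exact: open_chart_overlap.
have D := chart_segment_derive dthE U dt.
rewrite derive1E derive_val deriveEjacobian// -E (gram_transition cx (_ : dom d x)) -?gx// gx.
by rewrite coordK// /norm2 scalemxAl !trmx_mul !mulmxA.
Qed.

Lemma sum_ord_le (R : realType) (n : nat) (F : 'I_n -> R) (c : R) :
  (forall i, F i <= c) -> \sum_i F i <= n%:R * c.
Proof.
move=> Fc; apply: (@le_trans _ _ (\sum_(i < n) c)); first exact: ler_sum.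
by rewrite sumr_const card_ord mulr_natl.
Qed.

Lemma norm2_le (R : realType) (n : nat) (G : 'M[R]_n) (v : 'rV[R]_n) (B : R) :
  (forall i j, `|G i j| <= B) -> norm2 G v <= n%:R ^+ 2 * B * `|v| ^+ 2.
Proof.
move=> GB; have vi i : `|v 0 i| <= `|v| by exact: coord_le_norm.
rewrite /norm2 mxE (le_trans (ler_norm _))// (le_trans (ler_norm_sum _ _ _))//.
have -> : n%:R ^+ 2 * B * `|v| ^+ 2 = n%:R * (n%:R * (`|v| * B) * `|v|) by ring.
apply: sum_ord_le => j; rewrite !mxE normrM ler_pM//.
rewrite (le_trans (ler_norm_sum _ _ _))//; apply: sum_ord_le => i.
by rewrite normrM ler_pM.
Qed.

Lemma path_dist_ge0 (R : realType) (T : Type) (adm : (R -> T) -> Prop)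
    (sp : (R -> T) -> R -> R) (x y : T) :
  (forall gam t, 0 <= sp gam t) -> (0 <= path_dist adm sp x y)%E.
Proof.
move=> sp0; apply: le_ereal_inf_tmp => _ [s _ ->].
by apply: sume_ge0 => gam _; apply: integral_ge0 => t _; rewrite lee_fin.
Qed.

Lemma chain_rcons (R : realType) (T : Type) (adm : (R -> T) -> Prop) (x y : T)
    (s : seq (R -> T)) (gam : R -> T) :
  chain adm x y s -> adm gam -> gam 0 = y -> chain adm x (gam 1) (rcons s gam).
Proof. by elim: s x => [|g s IH] x /= => [-> //|[ag <- /IH h] a0 g0]; split => //; exact: h. Qed.

(** Any chain from [p] to [x] can be prolonged by [gam], whose length is at most [L] since the
    parameter interval has length 1. *)
Lemma path_dist_extend (R : realType) (T : Type) (adm : (R -> T) -> Prop)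
    (sp : (R -> T) -> R -> R) (p x : T) (gam : R -> T) (L : R) :
  adm gam -> gam 0 = x -> (forall t, 0 <= sp gam t <= L) ->
  (path_dist adm sp p (gam 1%R) <= path_dist adm sp p x + L%:E)%E.
Proof.
move=> ag g0 spL.
have lenL : (\int[@lebesgue_measure R]_(t in `[0%R, 1%R]) (sp gam t)%:E <= L%:E)%E.
  apply: le_trans (integral_le_cst _ (c := L) _ _ _) _.
  - exact: measurable_itv.
  - by move=> t _; rewrite lee_fin; case/andP: (spL t).
  - by move=> t _; rewrite lee_fin; case/andP: (spL t).
  - suff L1 : @lebesgue_measure R `[0%R, 1%R] = 1%E.
      by rewrite -[leRHS]mule1 le_eqVlt; apply/orP; left; apply/eqP; congr (_ * _)%E.
    by rewrite lebesgue_measure_itv/= lte_fin ltr01 oppr0 adde0.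
rewrite -leeBlDr//; apply: le_ereal_inf_tmp => _ [s cs ->].
rewrite leeBlDr//; apply: ereal_inf_le.
exists (\sum_(g <- rcons s gam) \int[@lebesgue_measure R]_(t in `[0%R, 1%R]) (sp g t)%:E)%E.
  by exists (rcons s gam) => //; exact: (chain_rcons cs ag g0).
by rewrite -cats1 big_cat big_seq1 leeD2l.
Qed.

(* Admissible curves are defined on the whole line, so a chart segment is run through with the
   bounded parameters [sin] and [cos] of [pi t / 2]. *)
Lemma riem_dist_near (R : realType) (n : nat) (N : riemannian R n) (x : N) (e : R) :
  0 < e -> \forall y \near x, forall p,
    (riem_dist p y <= riem_dist p x + e%:E)%E /\ (riem_dist p x <= riem_dist p y + e%:E)%E.
Proof.
move=> e0; set c := chart_at x; set x0 := coord c x; set U := coord c @` dom c.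
have cx : dom c x by exact: chart_atP.
have Ux0 : U x0 by exists x.
(* Near [x0] each Gram entry changes by at most 1, so [B] bounds them all; [1 <= B] later allows
   replacing [n^2 B] by [(n B)^2] under the square root. *)
pose B := 1 + \sum_i \sum_j `|gram c x0 i j|.
have S0 : 0 <= \sum_i \sum_j `|gram c x0 i j| by rewrite sumr_ge0// => i _; rewrite sumr_ge0.
have B1 : 1 <= B by rewrite lerDl.
have : \forall z \near x0, U z /\ forall ij : 'I_n * 'I_n, `|gram c z ij.1 ij.2| <= B.
  apply: filterI; first by apply: open_nbhs_nbhs; split => //; exact: open_codom.
  apply: (@filter_forall _ _ (fun (ij : 'I_n * 'I_n) z => `|gram c z ij.1 ij.2| <= B) (nbhs x0)).
  move=> [i j] /=; have [/(_ x0 Ux0) + _] := @smooth_gram _ _ N c i j 0%N.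
  move=> /cvgrPdist_le /(_ 1 ltr01); apply: filterS => z; rewrite distrC => zx.
  rewrite -(subrK (gram c x0 i j) (gram c z i j)) (le_trans (ler_normD _ _))// lerD//.
  rewrite (bigD1 i)//= (bigD1 j)//= -addrA lerDl addr_ge0// ?sumr_ge0// => k _.
  by rewrite sumr_ge0.
move=> /nbhs_ballP[r /= r0 rU].
pose K : R := pi / 2.
have K0 : 0 < K by rewrite divr_gt0// pi_gt0.
(* [K * n%:R * B] times the norm of [v] bounds the speed, [K] being the maximal rate of the
   parameter; the summand 1 makes [C] positive. *)
pose C := K * n%:R * B + 1.
have B0 : 0 <= B by rewrite (le_trans ler01).
have C0 : 0 < C by rewrite /C ltr_wpDl// mulr_ge0// mulr_ge0// ltW.
have N1 : nbhs x (dom c) by apply: open_nbhs_nbhs; split => //; exact: open_dom.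
have N2 : \forall y \near x, ball x0 (Num.min r (e / C)) (coord c y).
  have /(_ _ _) := @continuous_coord _ _ N c x cx; apply.
  by apply: nbhsx_ballx; rewrite lt_min r0 divr_gt0.
apply: filterS (filterI N1 N2) => y [cy].
rewrite -ball_normE /= distrC lt_min => /andP[vr ve] p; set v := coord c y - x0 in vr ve.
have Ev : x0 + v = coord c y by rewrite addrC subrK.
(* Used twice: the sine runs from [x] to [y] and the cosine from [y] to [x], which gives both
   inequalities without appeal to the symmetry of the distance. *)
have main (th dth : R -> R) (a b : N) :
    (forall t : R, is_derive t 1 th (dth t)) -> continuous dth ->
    (forall t, `|th t| <= 1) -> (forall t, `|dth t| <= K) ->
    param c (x0 + th 0 *: v) = a -> param c (x0 + th 1 *: v) = b ->
    (riem_dist p b <= riem_dist p a + e%:E)%E.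
  move=> dthE cdth th1 dthK a0 b1.
  have tv t : ball x0 r (x0 + th t *: v).
    rewrite -ball_normE /= opprD addrA subrr add0r normrN normrZ.
    by apply: le_lt_trans vr; rewrite ler_piMl.
  have UU t : U (x0 + th t *: v) by have [] := rU _ (tv t).
  rewrite -b1; apply: (path_dist_extend (gam := fun t => param c (x0 + th t *: v))
    p (chart_segment_Ck dthE cdth UU) a0) => t.
  rewrite sqrtr_ge0/= (chart_segment_speed dthE UU).
  rewrite -(ger0_norm (ltW e0)) -sqrtr_sqr ler_wsqrtr//.
  have [_ GB] := rU _ (tv t).
  apply: le_trans (norm2_le _ (B := B) _) _; first by move=> i j; exact: (GB (i, j)).
  have nB : 0 <= n%:R * B by rewrite mulr_ge0// (le_trans ler01).
  apply: (@le_trans _ _ ((n%:R * B * `|dth t *: v|) ^+ 2)).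
    rewrite !exprMn ler_wpM2r ?sqr_ge0// ler_wpM2l ?sqr_ge0// expr2 ler_peMl//.
  rewrite ler_pXn2r ?nnegrE ?mulr_ge0 ?(ltW e0)//.
  rewrite normrZ mulrA; apply: (@le_trans _ _ (C * `|v|)); last first.
    by rewrite mulrC -ler_pdivlMr// ltW.
  rewrite ler_wpM2r// /C (le_trans _ (_ : K * n%:R * B <= _))// ?lerDl//.
  by rewrite mulrC -mulrA ler_wpM2r.
pose l (t : R) := K * t.
have dl t : is_derive t (1 : R) l K.
  by rewrite /l; apply: is_derive_eq; rewrite [LHS]mulr1.
have cl t : {for t, continuous l} by apply: cvgM; [exact: cvg_cst|exact: cvg_id].
split.
- apply: (main (fun t => sin (l t)) (fun t => cos (l t) * K)).
  + move=> t; apply: cvgM; last exact: cvg_cst.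
    exact: (@continuous_comp _ _ _ l cos t (cl t) (@continuous_cos R _)).
  + by move=> t; rewrite ler_norml sin_geN1 sin_le1.
  + move=> t; rewrite normrM (ger0_norm (ltW K0)) ler_piMl ?(ltW K0)//.
    by rewrite ler_norml cos_geN1 cos_le1.
  + by rewrite /l mulr0 sin0 scale0r addr0 coordK.
  + by rewrite /l mulr1 sin_pihalf scale1r Ev coordK.
- apply: (main (fun t => cos (l t)) (fun t => - sin (l t) * K)).
  + move=> t; apply: cvgM; last exact: cvg_cst.
    apply: cvgN; exact: (@continuous_comp _ _ _ l sin t (cl t) (@continuous_sin R _)).
  + by move=> t; rewrite ler_norml cos_geN1 cos_le1.
  + move=> t; rewrite normrM normrN (ger0_norm (ltW K0)) ler_piMl ?(ltW K0)//.
    by rewrite ler_norml sin_geN1 sin_le1.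
  + by rewrite /l mulr0 cos0 scale1r Ev coordK.
  + by rewrite /l mulr1 cos_pihalf scale0r addr0 coordK.
Qed.

Lemma rdist_ge0 (R : realType) (n : nat) (N : riemannian R n) (p x : N) : 0 <= rdist p x.
Proof. by apply: fine_ge0; apply: path_dist_ge0 => *; exact: sqrtr_ge0. Qed.

(* The distance may be infinite, where [rdist] is 0; the points at finite distance form a clopen
   set, so this does not affect continuity. *)
Lemma rdist_continuous (R : realType) (n : nat) (N : riemannian R n) (p : N) :
  continuous (rdist p).
Proof.
move=> x; apply/cvgrPdist_le => e e0; have := riem_dist_near x e0.
apply: filterS => y /(_ p); rewrite /rdist.
have := path_dist_ge0 (Ck_curve 1) p x (fun gam t => sqrtr_ge0 _ : 0 <= @speed _ _ N gam t).
have := path_dist_ge0 (Ck_curve 1) p y (fun gam t => sqrtr_ge0 _ : 0 <= @speed _ _ N gam t).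
rewrite -!/(riem_dist _ _).
case: (riem_dist p x) => [a| |] //; case: (riem_dist p y) => [b| |] //= _ _ [] //.
  by rewrite !lee_fin => h1 h2; rewrite ler_distl; apply/andP; split; lra.
by move=> _ _; rewrite subrr normr0 ltW.
Qed.

(** Manifolds are locally connected: a point close to [y] is joined to [y] inside [U] by the image
    of a segment of a chart. *)
Lemma open_component_manifold (R : realType) (n : nat) (M : manifold R n) (U : set M) (o : M) :
  open U -> open (connected_component U o).
Proof.
move=> oU; rewrite openE => y yC.
have Uy : U y by exact: connected_component_sub yC.
set c := chart_at y; set y0 := coord c y.
have cy : dom c y by exact: chart_atP.
have : nbhs y0 (coord c @` dom c `&` param c @^-1` U).
  apply: filterI; first by apply: open_nbhs_nbhs; split; [exact: open_codom|exists y].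
  by apply: continuous_param => //; rewrite coordK//; exact: open_nbhs_nbhs.
move=> /nbhs_ballP[r /= r0 rU].
have N1 : nbhs y (dom c) by apply: open_nbhs_nbhs; split => //; exact: open_dom.
have N2 : \forall z \near y, ball y0 r (coord c z).
  have /(_ _ _) := @continuous_coord _ _ M c y cy; apply; exact: nbhsx_ballx.
apply: filterS (filterI N1 N2) => z [cz]; rewrite -ball_normE /= distrC => zr.
set v := coord c z - y0 in zr.
pose gam (t : R) := param c (y0 + t *: v).
have bt t : 0 <= t <= 1 -> ball y0 r (y0 + t *: v).
  move=> /andP[t0 t1]; rewrite -ball_normE /= opprD addrA subrr add0r normrN normrZ.
  by apply: le_lt_trans zr; rewrite ler_piMl// ger0_norm.
have g0 : gam 0 = y by rewrite /gam scale0r addr0 coordK.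
have g1 : gam 1 = z by rewrite /gam scale1r addrC subrK coordK.
have cg : connected (gam @` `[0, 1]).
  apply: connected_continuous_connected; first exact: segment_connected.
  apply: continuous_in_subspaceT => t; rewrite inE/= in_itv/= => /bt /rU [[x cx E] _].
  have c1 : {for t, continuous (fun t : R => y0 + t *: v)}.
    by apply: cvgD; [exact: cvg_cst|apply: cvgZr_tmp; exact: cvg_id].
  have c2 : {for y0 + t *: v, continuous (param c)}.
    by rewrite -E; exact: continuous_param.
  have H := @continuous_comp _ _ _ (fun t : R => y0 + t *: v) (param c) t c1 c2.
  exact: H.
apply: (connected_component_trans yC).
apply: (connected_component_max (B := gam @` `[0, 1])) => //.
- by exists 0 => //=; rewrite in_itv/= lexx ler01.
- by move=> x [t]; rewrite /= in_itv/= => /bt /rU [_ +] <-.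
- by exists 1 => //=; rewrite in_itv/= ler01 lexx.
Qed.

(** * Lebesgue measure of Euclidean balls *)

Definition box (R : realType) (m : nat) (a b : 'rV[R]_m) : set 'rV[R]_m :=
  [set x | forall i, a 0 i <= x 0 i <= b 0 i].

(** No order between the corners is imposed: the empty set is then a box, and the family is closed
    under intersection. *)
Definition boxes (R : realType) (m : nat) : set (set 'rV[R]_m) :=
  [set A | exists a b, A = box a b].

Lemma boxes_setI_closed (R : realType) (m : nat) : setI_closed (@boxes R m).
Proof.
move=> _ _ [a [b ->]] [a' [b' ->]].
exists (\row_i Num.max (a 0 i) (a' 0 i)), (\row_i Num.min (b 0 i) (b' 0 i)).
apply/seteqP; split => x /=.
  move=> [h h'] i; rewrite !mxE ge_max le_min.
  by have /andP[-> ->] := h i; have /andP[-> ->] := h' i.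
move=> h; split => i; have := h i; rewrite !mxE ge_max le_min => /andP[/andP[? ?] /andP[? ?]];
  exact/andP.
Qed.

Lemma closed_box (R : realType) (m : nat) (a b : 'rV[R]_m) : closed (box a b).
Proof.
rewrite (_ : box a b = \bigcap_(i in [set: 'I_m])
    ((fun x : 'rV[R]_m => x 0 i) @^-1` `[a 0 i, b 0 i]%classic)); last first.
  apply/seteqP; split => x /= h i; first by move=> _ /=; rewrite in_itv/=.
  by have := h i I; rewrite /= in_itv/=.
apply: closed_bigI => i _; apply: preimage_closed => [x _|]; last exact: interval_closed.
exact: coord_continuous.
Qed.

(** Rational corners make the union countable, hence usable in a sigma-algebra. *)
Lemma open_bigcup_boxes (R : realType) (m : nat) (U : set 'rV[R]_m) : open U ->
  U = \bigcup_(ab in [set ab : 'rV[rat]_m * 'rV[rat]_m |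
        box (map_mx ratr ab.1) (map_mx ratr ab.2) `<=` U])
      box (map_mx ratr ab.1) (map_mx ratr ab.2).
Proof.
move=> oU; apply/seteqP; split => [x Ux|x [ab abU]]; last exact: abU.
have /nbhs_ballP[e /= e0 eU] : nbhs x U by exact: open_nbhs_nbhs.
have lq i : exists q : rat, ratr q \in `](x 0 i - e), (x 0 i)[.
  by apply: rat_in_itvoo; rewrite ltrBlDr ltrDl.
have uq i : exists q : rat, ratr q \in `](x 0 i), (x 0 i + e)[.
  by apply: rat_in_itvoo; rewrite ltrDl.
pose a : 'rV[rat]_m := \row_i xchoose (lq i).
pose b : 'rV[rat]_m := \row_i xchoose (uq i).
have aP i : x 0 i - e < ratr (a 0 i) < x 0 i.
  by have := xchooseP (lq i); rewrite in_itv/= mxE.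
have bP i : x 0 i < ratr (b 0 i) < x 0 i + e.
  by have := xchooseP (uq i); rewrite in_itv/= mxE.
have am i : (map_mx ratr a : 'rV[R]_m) 0 i = ratr (a 0 i) by rewrite [LHS]mxE.
have bm i : (map_mx ratr b : 'rV[R]_m) 0 i = ratr (b 0 i) by rewrite [LHS]mxE.
exists (a, b) => /=; last first.
  by move=> i; rewrite am bm; have /andP[_ /ltW ->] := aP i; have /andP[/ltW -> _] := bP i.
move=> y yab; apply: eU; rewrite -ball_normE /=; apply: norm_rV_lt => // i.
have := yab i; rewrite am bm => /andP[h1 h2]; have /andP[h3 _] := aP i; have /andP[_ h4] := bP i.
rewrite [(x - y) 0 i]mxE [(- y) 0 i]mxE distrC ltr_distl; apply/andP; split; first exact: lt_le_trans h1.
exact: le_lt_trans h4.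
Qed.

Lemma borel_rVE (R : realType) (m : nat) :
  @measurable _ (borel 'rV[R]_m) = <<s @boxes R m >>.
Proof.
apply/seteqP; split; apply: smallest_sub; try exact: smallest_sigma_algebra.
- move=> U /open_bigcup_boxes ->.
  set F := fun ab : 'rV[rat]_m * 'rV[rat]_m => _.
  rewrite bigcup_mkcond.
  apply: (@countable_bigcupT_measurable _ (g_sigma_algebraType (@boxes R m)) _ _ _) => [|ab].
    exact: countableP.
  case: ifPn => _; last exact: measurable0.
  by apply: sub_sigma_algebra; exists (map_mx ratr ab.1), (map_mx ratr ab.2).
- move=> _ [a [b ->]]; rewrite -(setCK (box a b)); apply: sigma_algebraC.
  by apply: sub_sigma_algebra; apply/closed_openC/closed_box.
Qed.

Lemma measurable_open (T : ptopologicalType) (U : set T) : open U -> measurable (U : set (borel T)).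
Proof. exact: sub_sigma_algebra. Qed.

Lemma continuous_borel (T U : ptopologicalType) (f : T -> U) : continuous f ->
  measurable_fun setT (f : borel T -> borel U).
Proof.
move=> cf; apply: (@measurability _ _ (borel T) (borel U) setT f (@open U) erefl).
move=> _ [V oV <-]; rewrite setTI; apply: measurable_open.
by apply: open_comp => // x _; exact: cf.
Qed.

(** Both sides are measures in [A] and agree on boxes, where [is_lebesgue] prescribes the value;
    uniqueness on the family of boxes does the rest. *)
Lemma lebesgue_scale (R : realType) (m : nat) (lam : {measure set (borel 'rV[R]_m) -> \bar R})
    (c : R) (A : set (borel 'rV[R]_m)) :
  is_lebesgue lam -> 0 < c -> measurable A ->
  lam [set x | A (c^-1 *: x)] = ((c ^+ m)%:E * lam A)%E.
Proof.
move=> lamE c0 mA.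
pose f (x : borel 'rV[R]_m) : borel 'rV[R]_m := c^-1 *: (x : 'rV[R]_m).
have mf : measurable_fun setT f.
  have cs : continuous (fun x : 'rV[R]_m => c^-1 *: x) by exact: scaler_continuous.
  exact: (continuous_borel cs).
have [p pE] := pushforward_is_measure lam mf.
pose cm : {nonneg R} := NngNum (exprn_ge0 m (ltW c0)).
suff : p A = mscale cm lam A by rewrite pE.
(* [is_lebesgue] is silent on boxes with a reversed side; these are empty. *)
have boxE (a b : 'rV[R]_m) : (forall i, a 0 i <= b 0 i) \/ box a b = set0.
  have [|/asboolPn/existsp_asboolPn[i /negP]] := pselect (forall i, a 0 i <= b 0 i); first by left.
  rewrite -ltNge => ab; right; rewrite -subset0 => x /(_ i) /andP[h1 h2].
  by move: (le_lt_trans (le_trans h1 h2) ab); rewrite ltxx.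
have preE (a b : 'rV[R]_m) : f @^-1` box a b = box (c *: a) (c *: b).
  apply/seteqP; split => x h i; have := h i;
    by rewrite !mxE [c^-1 * _]mulrC ler_pdivlMr// ler_pdivrMr// ![c * _]mulrC.
have := @measure_unique _ R (borel 'rV[R]_m) (@boxes R m)
  (fun k => box (const_mx (- k%:R)) (const_mx k%:R)) _ _ _ _ p (mscale cm lam).
apply.
- exact: borel_rVE.
- exact: boxes_setI_closed.
- by move=> k; exists (const_mx (- k%:R)), (const_mx k%:R).
- apply/seteqP; split => // x _; exists (Num.bound `|x : 'rV[R]_m|) => // i.
  rewrite !mxE -ler_norml; apply: le_trans (coord_le_norm _ _) (ltW _).
  exact: archi_boundP.
- move=> _ [a [b ->]]; rewrite pE /pushforward preE.
  have [ab|ab0] := boxE a b; last first.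
    by rewrite -preE ab0 preimage_set0 !measure0.
  transitivity ((c ^+ m)%:E * lam (box a b))%E; last by [].
  rewrite [in LHS](lamE (c *: a) (c *: b)); last first.
    by move=> i; rewrite !mxE ler_pM2l.
  rewrite (lamE a b ab) -EFinM; congr EFin.
  rewrite -[X in _ ^+ X](card_ord m) -prodr_const -big_split/=.
  by apply: eq_bigr => i _; rewrite !mxE mulrBr.
- move=> k; rewrite pE /pushforward preE [X in (X < _)%E](lamE _ _) ?ltry// => i.
  by rewrite !mxE ler_pM2l// lerNl (le_trans _ (ler0n _ k))// oppr_le0.
- exact: mA.
Qed.

Lemma enormE (R : realType) (m : nat) (x : 'rV[R]_m) :
  enorm x = Num.sqrt (\sum_i x 0 i ^+ 2).
Proof. by rewrite /enorm mxE; congr Num.sqrt; apply: eq_bigr => i _; rewrite mxE. Qed.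

Lemma enorm_ge0 (R : realType) (m : nat) (x : 'rV[R]_m) : 0 <= enorm x.
Proof. exact: sqrtr_ge0. Qed.

Lemma enorm_sqr (R : realType) (m : nat) (x : 'rV[R]_m) : enorm x ^+ 2 = \sum_i x 0 i ^+ 2.
Proof. by rewrite enormE sqr_sqrtr// sumr_ge0// => i _; exact: sqr_ge0. Qed.

Lemma enormZ (R : realType) (m : nat) (c : R) (x : 'rV[R]_m) :
  enorm (c *: x) = `|c| * enorm x.
Proof.
rewrite !enormE -sqrtr_sqr -sqrtrM ?sqr_ge0//; congr Num.sqrt.
by rewrite mulr_sumr; apply: eq_bigr => i _; rewrite mxE exprMn.
Qed.

Lemma coord_le_enorm (R : realType) (m : nat) (x : 'rV[R]_m) (i : 'I_m) : `|x 0 i| <= enorm x.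
Proof.
rewrite enormE -sqrtr_sqr ler_wsqrtr// (bigD1 i)//= lerDl sumr_ge0// => j _; exact: sqr_ge0.
Qed.

Lemma enorm_continuous (R : realType) (m : nat) : continuous (@enorm R m).
Proof.
move=> x; rewrite (_ : @enorm R m = Num.sqrt \o (fun x : 'rV[R]_m => \sum_i x 0 i ^+ 2)); last first.
  by apply/funext => y; rewrite enormE.
apply: continuous_comp; last exact: sqrt_continuous.
rewrite (_ : (fun x : 'rV[R]_m => \sum_i x 0 i ^+ 2) =
  \sum_i (fun x : 'rV[R]_m => x 0 i) ^+ 2); last first.
  by apply/funext => y; rewrite fct_sumE.
apply/differentiable_continuous/differentiable_sum => i.
exact/differentiableX/differentiable_coord.
Qed.

Lemma enorm_lt_open (R : realType) (m : nat) (r : R) : open [set x : 'rV[R]_m | enorm x < r].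
Proof.
apply: (@open_comp _ _ (@enorm R m) [set t | t < r]) => [x _|]; last exact: open_lt.
exact: enorm_continuous.
Qed.

(** Scaling reduces to the unit ball, whose measure is positive and finite because the ball contains
    one cube and lies in another. *)
Lemma lebesgue_ball (R : realType) (m : nat) (lam : {measure set (borel 'rV[R]_m) -> \bar R}) :
  (0 < m)%N -> is_lebesgue lam ->
  exists2 c : R, 0 < c & forall r, 0 <= r -> lam [set x | enorm x < r] = (c * r ^+ m)%:E.
Proof.
move=> m0 lamE; pose B1 : set 'rV[R]_m := [set x | enorm x < 1].
have mB r : measurable ([set x | enorm x < r] : set (borel 'rV[R]_m)).
  by apply: (@measurable_open 'rV[R]_m); exact: enorm_lt_open.
have mbox (a b : 'rV[R]_m) : measurable (box a b : set (borel 'rV[R]_m)).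
  by rewrite borel_rVE; apply: sub_sigma_algebra; exists a, b.
have up : (lam B1 < +oo)%E.
  apply: (@le_lt_trans _ _ (lam (box (const_mx (-1)) (const_mx 1)))).
    apply: le_measure; rewrite ?inE//; first exact: mB.
    move=> x /= x1 i; rewrite !mxE -ler_norml.
    exact: le_trans (coord_le_enorm _ _) (ltW x1).
  by rewrite lamE ?ltry// => i; rewrite !mxE; lra.
have lo : (0 < lam B1)%E.
  (* With this half-side the cube lies in the unit ball: the squared norm is at most
     [m / (m+1)^2 < 1]. *)
  pose e : R := m.+1%:R^-1.
  have e0 : 0 < e by rewrite invr_gt0.
  apply: (@lt_le_trans _ _ (lam (box (const_mx (- e)) (const_mx e)))).
    rewrite lamE; last by move=> i; rewrite !mxE; lra.
    by rewrite lte_fin; apply: prodr_gt0 => i _; rewrite !mxE; lra.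
  apply: le_measure; rewrite ?inE//; first exact: mB.
  move=> x /= xe; rewrite /B1/= -(@ltr_pXn2r _ 2) ?nnegrE ?enorm_ge0// expr1n enorm_sqr.
  apply: (@le_lt_trans _ _ (m%:R * e ^+ 2)).
    apply: sum_ord_le => i; rewrite -real_normK ?num_real// lerXn2r ?nnegrE ?(ltW e0)//.
    by have := xe i; rewrite !mxE -ler_norml.
  rewrite /e exprVn ltr_pdivrMr ?exprn_gt0// mul1r -natrX ltr_nat.
  by rewrite -mulnn (leq_trans (ltnSn _))// leq_pmulr.
exists (fine (lam B1)); first by apply: fine_gt0; rewrite lo up.
move=> r; rewrite le_eqVlt => /predU1P[<-|r0].
  rewrite expr0n eqn0Ngt m0 mulr0 [X in lam X](_ : _ = set0) ?measure0//.
  by rewrite -subset0 => x /=; rewrite ltNge enorm_ge0.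
rewrite mulrC EFinM fineK; last by rewrite ge0_fin_numE.
rewrite -(lebesgue_scale lamE r0 (mB 1)); congr (lam _).
apply/seteqP; split => x /=; rewrite enormZ ger0_norm ?invr_ge0 ?(ltW r0)//;
  by rewrite mulrC ltr_pdivrMr// mul1r.
Qed.

(** * Balls of model spaces *)

Lemma continuous_sum (T : topologicalType) (R : realType) (n : nat) (F : 'I_n -> T -> R) (x : T) :
  (forall i, {for x, continuous (F i)}) -> {for x, continuous (fun t => \sum_i F i t)}.
Proof.
move=> cF; rewrite (_ : (fun t => _) = \sum_i F i); last by apply/funext => t; rewrite fct_sumE.
apply: (@big_ind _ (fun f : T -> R => {for x, continuous f})) => [|f g cf cg|i _] //.
- exact: cst_continuous.
- exact: cvgD.
Qed.

Definition dot (R : realType) (m : nat) (x v : 'rV[R]_m) : R := (x *m v^T) 0 0.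

Lemma dotE (R : realType) (m : nat) (x v : 'rV[R]_m) : dot x v = \sum_i x 0 i * v 0 i.
Proof. by rewrite /dot mxE; apply: eq_bigr => i _; rewrite mxE. Qed.

Lemma dotC (R : realType) (m : nat) (x v : 'rV[R]_m) : dot x v = dot v x.
Proof. by rewrite !dotE; apply: eq_bigr => i _; rewrite mulrC. Qed.

Lemma dot0v (R : realType) (m : nat) (v : 'rV[R]_m) : dot 0 v = 0.
Proof. by rewrite dotE big1// => i _; rewrite mxE mul0r. Qed.

Lemma enorm_dot (R : realType) (m : nat) (x : 'rV[R]_m) : enorm x ^+ 2 = dot x x.
Proof. by rewrite enorm_sqr dotE; apply: eq_bigr => i _; rewrite expr2. Qed.

Lemma enorm_eq0 (R : realType) (m : nat) (x : 'rV[R]_m) : (enorm x == 0) = (x == 0).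
Proof.
apply/eqP/eqP => [x0|->]; last first.
  by rewrite enormE big1 ?sqrtr0// => i _; rewrite mxE expr0n.
apply/rowP => i; rewrite mxE; apply/eqP; rewrite -normr_eq0 eq_le normr_ge0 andbT -x0.
exact: coord_le_enorm.
Qed.

(** Cauchy-Schwarz: the defect, multiplied by the squared norm of [x], is the squared norm of
    [|x|^2 v - <x,v> x]. *)
Lemma dot_le_enorm (R : realType) (m : nat) (x v : 'rV[R]_m) :
  dot x v ^+ 2 <= enorm x ^+ 2 * enorm v ^+ 2.
Proof.
have [->|x0] := eqVneq x 0.
  by rewrite dot0v expr0n mulr_ge0// sqr_ge0.
have nx0 : 0 < enorm x ^+ 2 by rewrite exprn_gt0// lt0r enorm_ge0 enorm_eq0 x0.
rewrite -subr_ge0 -(pmulr_rge0 _ nx0).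
suff -> : enorm x ^+ 2 * (enorm x ^+ 2 * enorm v ^+ 2 - dot x v ^+ 2) =
  enorm (enorm x ^+ 2 *: v - dot x v *: x) ^+ 2 by exact: sqr_ge0.
set a := enorm x ^+ 2; set d := dot x v.
rewrite [RHS]enorm_sqr.
under [RHS]eq_bigr do rewrite !mxE.
have -> : \sum_i (a * v 0 i - d * x 0 i) ^+ 2 =
    a ^+ 2 * (\sum_i v 0 i ^+ 2) - 2 * a * d * (\sum_i x 0 i * v 0 i) + d ^+ 2 * \sum_i x 0 i ^+ 2.
  by rewrite !mulr_sumr -sumrB -big_split/=; apply: eq_bigr => i _; ring.
by rewrite -dotE -!enorm_sqr -/a -/d; ring.
Qed.

Lemma norm2_mgram (R : realType) (m : nat) (X : model R) (x v : 'rV[R]_m) : x != 0 ->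
  norm2 (mgram X x) v = enorm x ^- 2 * dot x v ^+ 2 +
    (mwarp X (enorm x) / enorm x) ^+ 2 * (enorm v ^+ 2 - enorm x ^- 2 * dot x v ^+ 2).
Proof.
move=> x0; rewrite /norm2 /mgram (negbTE x0).
set k := _ / _.
have rE : v *m (enorm x ^- 2 *: (x^T *m x)) *m v^T = (enorm x ^- 2 * dot x v ^+ 2)%:M.
  rewrite -scalemxAr -scalemxAl [v *m (_ *m _)]mulmxA -[v *m _ *m _ *m _]mulmxA.
  rewrite [x *m v^T]mx11_scalar [v *m x^T]mx11_scalar -scalar_mxM scale_scalar_mx.
  by rewrite -/(dot x v) -/(dot v x) dotC expr2.
have vE : v *m v^T = (enorm v ^+ 2)%:M by rewrite [LHS]mx11_scalar enorm_dot.
rewrite mulmxDr mulmxDl rE -[v *m (k ^+ 2 *: _)]scalemxAr -scalemxAl mulmxBr mulmxBl mulmx1 rE vE.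
by rewrite !mxE eqxx !mulr1n.
Qed.

(** The tangential term is nonnegative whatever the warping function, so the speed is at least the
    radial component of the velocity. *)
Lemma dot_le_mspeed (R : realType) (m : nat) (X : model R) (x v : 'rV[R]_m) :
  `|dot x v| <= enorm x * Num.sqrt (norm2 (mgram X x) v).
Proof.
have [->|x0] := eqVneq x 0.
  by rewrite dot0v normr0 mulr_ge0// ?sqrtr_ge0// enorm_ge0.
have nx : 0 < enorm x by rewrite lt0r enorm_ge0 enorm_eq0 x0.
have nx2 : 0 < enorm x ^+ 2 by rewrite exprn_gt0.
rewrite -[leLHS]sqrtr_sqr -[enorm x]ger0_norm ?enorm_ge0// -sqrtr_sqr -sqrtrM ?sqr_ge0//.
rewrite ler_wsqrtr// norm2_mgram// mulrDr mulrA mulfV ?mul1r ?lt0r_neq0//.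
rewrite lerDl mulr_ge0 ?sqr_ge0// mulr_ge0 ?sqr_ge0// subr_ge0.
by rewrite mulrC ler_pdivrMr// mulrC dot_le_enorm.
Qed.

Lemma mspeed_radial (R : realType) (m : nat) (X : model R) (x : 'rV[R]_m) (t : R) :
  Num.sqrt (norm2 (mgram X (t *: x)) x) = enorm x.
Proof.
have [tx0|tx0] := eqVneq (t *: x) 0.
  rewrite /norm2 /mgram tx0 eqxx mulmx1 -[(_ *m _) _ _]/(dot x x) -enorm_dot.
  by rewrite sqrtr_sqr ger0_norm// enorm_ge0.
rewrite norm2_mgram//.
have [t0 x0] : t != 0 /\ x != 0.
  by split; apply: contra_neq tx0 => ->; rewrite ?scale0r ?scaler0.
have nx : enorm x != 0 by rewrite enorm_eq0.
have nt : `|t| ^+ 2 != 0 by rewrite real_normK ?num_real// sqrf_eq0.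
have -> : dot (t *: x) x = t * enorm x ^+ 2.
  by rewrite enorm_dot !dotE mulr_sumr; apply: eq_bigr => i _; rewrite mxE mulrA.
have -> : enorm (t *: x) ^- 2 * (t * enorm x ^+ 2) ^+ 2 = enorm x ^+ 2.
  rewrite enormZ exprMn [(t * _) ^+ 2]exprMn -[t ^+ 2]real_normK ?num_real//.
  by field; rewrite normr_eq0 t0 nx.
by rewrite subrr mulr0 addr0 sqrtr_sqr ger0_norm// enorm_ge0.
Qed.

(* The radius is regularized to [sqrt (e + |x|^2)], which is differentiable at the center. *)
Lemma mspeed_lower (R : realType) (m : nat) (X : model R) (gam : R -> 'rV[R]_m) (e : R) :
  0 < e -> mcurve X gam ->
  ((Num.sqrt (e + enorm (gam 1) ^+ 2) - Num.sqrt (e + enorm (gam 0) ^+ 2))%:E <=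
   \int[@lebesgue_measure R]_(t in `[0%R, 1%R]) (mspeed X gam t)%:E)%E.
Proof.
move=> e0 [[cgam C1] _].
have dgam (t : R) : derivable gam t 1 by have [/(_ t I)] := C1 1.
have cdgam (t : R) : {for t, continuous ('D_1 gam)} by have [_ [/(_ t I)]] := C1 1.
pose q (t : R) := e + \sum_i gam t 0 i ^+ 2.
have qE t : q t = e + enorm (gam t) ^+ 2 by rewrite enorm_sqr.
have q0 t : 0 < q t by rewrite qE ltr_pwDl// sqr_ge0.
have comp i (t : R) : is_derive t (1 : R) (fun t : R => gam t 0 i) (('D_1 gam) t 0 i).
  have := dgam t => /derivable_mxP/(_ 0 i) d.
  by apply: DeriveDef => //; rewrite derive_mx// mxE.
have dq (t : R) : is_derive t (1 : R) q (2 * dot (gam t) ('D_1 gam t)).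
  have -> : q = cst e + \sum_i (fun t => gam t 0 i) ^+ 2.
    by apply/funext => s; rewrite /q /= fct_sumE.
  apply: is_derive_eq.
  rewrite add0r dotE mulr_sumr; apply: eq_bigr => i _.
  by rewrite expr1 mulrA.
pose F (t : R) := Num.sqrt (q t).
pose f (t : R) := dot (gam t) ('D_1 gam t) / F t.
have F0 t : 0 < F t by rewrite sqrtr_gt0.
have dF (t : R) : is_derive t (1 : R) F (f t).
  have d1 := is_derive1_comp (is_derive1_sqrt (q0 t)) (dq t).
  have -> : f t = (2 * Num.sqrt (q t))^-1 * (2 * dot (gam t) ('D_1 gam t)).
    by rewrite /f /F; field; rewrite gt_eqF// F0.
  exact: d1.
have cF : continuous F.
  by move=> t; apply/differentiable_continuous/derivable1_diffP; case: (dF t).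
have cf : continuous f.
  move=> t; have cn : {for t, continuous (fun t => dot (gam t) ('D_1 gam t))}.
    rewrite (_ : (fun t => dot (gam t) ('D_1 gam t)) =
      (fun t => \sum_i gam t 0 i * ('D_1 gam) t 0 i)); last by apply/funext => s; rewrite dotE.
    apply: continuous_sum => i.
    have c1 := @continuous_comp _ _ _ gam (fun x => x 0 i) t (cgam t I) (@coord_continuous R 1 m 0 i _).
    have c2 := @continuous_comp _ _ _ ('D_1 gam) (fun x => x 0 i) t (cdgam t) (@coord_continuous R 1 m 0 i _).
    exact: cvgM c1 c2.
  apply: cvgM; first exact: cn.
  by apply: cvgV; [rewrite gt_eqF|exact: cF].
(* [F] is at least the Euclidean norm of [gam], so the bound on the radial component applies, the
   center included. *)
have le1 t : `|f t| <= mspeed X gam t.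
  rewrite /f normrM normfV (ger0_norm (ltW (F0 t))) ler_pdivrMr//.
  apply: le_trans (dot_le_mspeed X _ _) _; rewrite /mspeed derive1E mulrC ler_wpM2l ?sqrtr_ge0//.
  rewrite -[leLHS]ger0_norm ?enorm_ge0// -sqrtr_sqr ler_wsqrtr// qE lerDr ltW//.
rewrite -!qE.
have := @continuous_FTC2 R f F 0 1 ltr01.
move=> FTC.
have E : (\int[lebesgue_measure]_(x in `[0%R, 1%R]) (f x)%:E)%E = ((F 1)%:E - (F 0)%:E)%E.
  apply: FTC.
  - exact: continuous_subspaceT.
  - split; first by move=> t _; case: (dF t).
    + by apply: cvg_at_right_filter; exact: cF.
    + by apply: cvg_at_left_filter; exact: cF.
  - by move=> t _; rewrite derive1E; case: (dF t).
rewrite EFinB -E.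
apply: le_trans (lee_abs _) _; apply: le_trans (le_abse_integral _ _ _) _ => //.
  apply/measurable_EFinP; apply: measurable_funTS; exact: continuous_measurable_fun.
apply: ge0_le_integral_nonmeasurable => t _; first exact: abse_ge0.
by rewrite lee_fin.
Qed.

(** The bounds of [mspeed_lower] telescope along a chain. With regularization [e ^+ 2] the starting
    point contributes exactly [e], which is arbitrarily small. *)
Lemma mdist_ge_enorm (R : realType) (m : nat) (X : model R) (x : 'rV[R]_m) :
  ((enorm x)%:E <= Defs.mdist X 0 x)%E.
Proof.
have chainP (e : R) (y : 'rV[R]_m) s : 0 < e -> chain (mcurve X) y x s ->
    ((Num.sqrt (e + enorm x ^+ 2) - Num.sqrt (e + enorm y ^+ 2))%:E <=
      \sum_(gam <- s) \int[@lebesgue_measure R]_(t in `[0%R, 1%R]) (mspeed X gam t)%:E)%E.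
  move=> e0; elim: s y => [|gam s IH] y /=.
    by move=> <-; rewrite big_nil subrr.
  move=> [cg <- /IH h]; rewrite big_cons.
  apply: le_trans (leeD (mspeed_lower e0 cg) h); rewrite -EFinD lee_fin; lra.
apply: le_ereal_inf_tmp => _ [s cs ->]; apply/lee_addgt0Pr => e e0.
have e20 : 0 < e ^+ 2 by rewrite exprn_gt0.
rewrite -leeBlDr//; apply: le_trans (chainP _ _ _ e20 cs).
have -> : enorm (0 : 'rV[R]_m) = 0 by apply/eqP; rewrite enorm_eq0.
rewrite expr0n addr0 sqrtr_sqr (ger0_norm (ltW e0)) -EFinB lee_fin lerD2r.
by rewrite -[leLHS]ger0_norm ?enorm_ge0// -sqrtr_sqr ler_wsqrtr// lerDr ltW.
Qed.

(** The ray from the center has constant speed [enorm x] and attains the lower bound; the downward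
    closed base keeps it inside the model. *)
Lemma mdistE (R : realType) (m : nat) (X : model R) (x : 'rV[R]_m) :
  (forall s t : R, 0 <= s <= t -> mbase X t -> mbase X s) -> Defs.mset X x ->
  Defs.mdist X 0 x = (enorm x)%:E.
Proof.
move=> Xdown Xx; apply/eqP; rewrite eq_le mdist_ge_enorm andbT.
pose gam (t : R) := t *: x.
have dg (t v : R) : is_derive t v gam (v *: x).
  have E : \forall h \near 0^', h^-1 *: ((gam \o shift t) (h *: v) - gam t) = v *: x.
    near=> h; have h0 : h != 0 by near: h; exact: nbhs_dnbhs_neq.
    by rewrite /gam/= scalerDl addrK scalerA mulrA mulVf// mul1r.
  by split; [apply: (@is_cvg_near_cst _ _ (v *: x)); exact: E|apply: lim_near_cst => //; exact: E].
have cg : mcurve X gam.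
  split; last first.
    move=> t /andP[t0 t1]; apply: Xdown Xx; rewrite enorm_ge0/= enormZ ger0_norm//.
    by rewrite ler_piMl ?enorm_ge0.
  split; first by move=> t _; apply/differentiable_continuous/derivable1_diffP; case: (dg t 1).
  move=> v; split; first by move=> t _; case: (dg t v).
  split=> // t _; rewrite (_ : 'D_v gam = cst (v *: x)); first exact: cst_continuous.
  by apply/funext => s; case: (dg s v).
apply: ereal_inf_le.
exists (\int[@lebesgue_measure R]_(t in `[0%R, 1%R]) (mspeed X gam t)%:E)%E.
  by exists [:: gam]; [split; rewrite /gam ?scale0r// scale1r|rewrite big_seq1].
apply: le_trans (integral_le_cst _ (c := enorm x) _ _ _) _.
- exact: measurable_itv.
- by move=> t _; rewrite lee_fin sqrtr_ge0.
- move=> t _; rewrite lee_fin /mspeed derive1E; have [_ ->] := dg t 1.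
  by rewrite scale1r mspeed_radial.
- suff L1 : @lebesgue_measure R `[0%R, 1%R] = 1%E.
    by rewrite -[leRHS]mule1 le_eqVlt; apply/orP; left; apply/eqP; congr (_ * _)%E.
  by rewrite lebesgue_measure_itv/= lte_fin ltr01 oppr0 adde0.
Unshelve. all: by end_near. Qed.
(** * The comparison space *)

Lemma within_proper (R : realType) (I : set R) (x : R) :
  (forall e, 0 < e -> exists2 y, I y & y != x /\ `|y - x| < e) ->
  ProperFilter (within (I `\ x) (nbhs x)).
Proof.
move=> acc; apply: within_nbhs_proper => A /nbhs_ballP[e /= e0 eA].
have [y Iy [yx ye]] := acc e e0; exists y; split; last by apply: eA; rewrite /ball/= distrC.
by split => //= /eqP; rewrite (negbTE yx).
Qed.

(** Properness of the filter makes the limit in [derive_in] unique. Points are found to the right of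
    [x], and to the left only when [x] is the end point [b]. *)
Lemma segment_within_proper (R : realType) (I : set R) (a b x : R) : a < b ->
  (forall y, a <= y <= b -> I y) -> a <= x <= b ->
  ProperFilter (within (I `\ x) (nbhs x)).
Proof.
move=> ab abI /andP[ax xb]; apply: within_proper => e e0.
have [xb'|bx] := ltP x b.
  pose y := Num.min b (x + e / 2).
  have xy : x < y by rewrite lt_min xb' ltrDl divr_gt0.
  exists y; first by apply: abI; rewrite (le_trans ax (ltW xy))/= ge_min lexx.
  split; first by rewrite gt_eqF.
  rewrite ger0_norm ?subr_ge0 ?(ltW xy)// ltrBlDl gt_min; apply/orP; right; lra.
have xE : x = b by apply/eqP; rewrite eq_le xb.
pose y := Num.max a (x - e / 2).
have yx : y < x by rewrite gt_max xE ab gtrBl divr_gt0.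
exists y; first by apply: abI; rewrite le_max lexx/= (le_trans (ltW yx)).
split; first by rewrite lt_eqF.
by rewrite distrC ger0_norm ?subr_ge0 ?(ltW yx)// ltrBlDl -ltrBlDr lt_max; apply/orP; right; lra.
Qed.

Lemma is_derive_in_unique (R : realType) (I : set R) (f : R -> R) (x l : R) :
  ProperFilter (within (I `\ x) (nbhs x)) -> is_derive_in I f x l -> derive_in I f x = l.
Proof. by move=> PF fl; apply: cvg_lim. Qed.

Lemma smooth_in_derive (R : realType) (I : set R) (f : R -> R) (x : R) (k : nat) :
  ProperFilter (within (I `\ x) (nbhs x)) -> smooth_in I f -> I x ->
  is_derive_in I (iter k (derive_in I) f) x (iter k.+1 (derive_in I) f x).
Proof.
by move=> PF sf Ix; have [l fl] := sf k x Ix; rewrite iterS (is_derive_in_unique PF fl).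
Qed.

Lemma is_derive_in_cvg (R : realType) (I : set R) (f : R -> R) (x l : R) :
  is_derive_in I f x l -> f @ within (I `\ x) (nbhs x) --> f x.
Proof.
move=> fl.
have c1 : (fun y => (f y - f x) / (y - x) * (y - x) + f x) @ within (I `\ x) (nbhs x) --> l * (x - x) + f x.
  apply: cvgD; last exact: cvg_cst.
  apply: cvgM; first exact: fl.
  apply: cvgB; last exact: cvg_cst.
  by apply: cvg_within_filter; exact: cvg_id.
rewrite subrr mulr0 add0r in c1.
apply: cvg_trans c1; apply: near_eq_cvg; rewrite near_withinE; near=> y => -[Iy /eqP/= yx].
by rewrite divfK ?subrK// subr_eq0.
Unshelve. all: by end_near. Qed.

Lemma is_derive_in_continuous (R : realType) (I A : set R) (f : R -> R) :
  A `<=` I -> (forall x, A x -> exists l, is_derive_in I f x l) -> {within A, continuous f}.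
Proof.
move=> AI df; apply/subspace_continuousP => x Ax; have [l fl] := df x Ax.
have := is_derive_in_cvg fl => /cvgrPdist_le h; apply/cvgrPdist_le => e e0.
have := h e e0; rewrite !near_withinE; apply: filterS => y yI Ay.
have [->|yx] := eqVneq y x; first by rewrite subrr normr0 ltW.
by apply: yI; split; [exact: AI|move=> /= /eqP; rewrite (negbTE yx)].
Qed.

Lemma base_interval_segment (R : realType) (I : set R) (b : R) : base_interval I ->
  I b -> forall x, 0 <= x <= b -> I x.
Proof.
move=> [[R0 _ ->]|->]; rewrite /= !in_itv/= ?andbT.
  by move=> /andP[_ bR] x /andP[x0 xb]; rewrite in_itv/= x0 (le_trans xb).
by move=> _ x /andP[x0 _]; rewrite in_itv/= x0.
Qed.

Lemma base_interval_ge0 (R : realType) (I : set R) (b : R) : base_interval I -> I b -> 0 <= b.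
Proof. by move=> [[R0 _ ->]|->]; rewrite /= in_itv/= => /andP[]. Qed.

Lemma base_interval_pos (R : realType) (I : set R) : base_interval I -> exists2 b, 0 < b & I b.
Proof.
move=> [[R0 R00 ->]|->]; first by exists R0; rewrite //= in_itv/= lexx ltW.
by exists 1; rewrite //= in_itv/= ler01.
Qed.
(* At 0 the function [Lam w g] has derivative [m Lam(0)], while its difference quotient is
   asymptotic to [Lam].  Hence [Lam] tends to [m Lam(0)], which contradicts the differentiability
   of the power of [Lam] at 0 unless [Lam 0 = 0] ([powR] is 1 on negative reals). *)
Lemma comparison_Lam0 (R : realType) (m : nat) (I : set R) (w g h Lam : R -> R) :
  (1 < m)%N -> comparison_data m I w g h Lam -> Lam 0 = 0.
Proof.
move=> m1 [bI [sw w0 w1 wpos] sh [sg g01 g0] [dq df]].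
have [b b0 Ib] := base_interval_pos bI.
have I0 : I 0 by apply: (base_interval_segment bI Ib); rewrite lexx ltW.
set F := within (I `\ (0 : R)) (nbhs (0 : R)).
have PF : ProperFilter F.
  apply: (segment_within_proper b0 (base_interval_segment bI Ib)).
  by rewrite lexx ltW.
have near_pos : \forall y \near F, I y /\ 0 < y.
  rewrite near_withinE; near=> y => -[Iy /eqP/= y0]; split => //.
  by rewrite lt0r y0 (base_interval_ge0 bI Iy).
pose p : R := m.-1%:R^-1.
have p0 : 0 < p by rewrite invr_gt0 ltr0n -subn1 subn_gt0.
have wl : (w y / y) @[y --> F] --> (1 : R).
  have := smooth_in_derive (k := 0) PF sw I0; rewrite /= w1 /is_derive_in w0.
  by under eq_fun do rewrite !subr0.
have gl : g y @[y --> F] --> (1 : R).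
  by have := smooth_in_derive (k := 0) PF sg I0 => /= /is_derive_in_cvg; rewrite g0.
have ql : (Lam y * w y * g y / y) @[y --> F] --> m%:R * Lam 0.
  have := dq 0 I0; rewrite g0 w0 w1 mulr0 subr0 mulr1 divr1 /is_derive_in w0 mulr0 mul0r.
  by under eq_fun do rewrite !subr0.
have Ll : Lam y @[y --> F] --> m%:R * Lam 0.
  have : (Lam y * w y * g y / y / (w y / y * g y)) @[y --> F] --> m%:R * Lam 0 / (1 * 1).
    apply: cvgM; first exact: ql.
    by apply: cvgV; [rewrite mulr1 oner_eq0|exact: (cvgM wl gl)].
  rewrite mulr1 divr1; apply: cvg_trans; apply: near_eq_cvg.
  apply: filterS near_pos => y [Iy y0]; have wy := wpos y Iy y0; have /andP[gy _] := g01 y Iy.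
  by field; rewrite !gt_eqF.
have fl := is_derive_in_cvg df.
have [L0|L0|//] := ltrgtP (Lam 0) 0.
  have Lneg : \forall y \near F, Lam y < 0.
    have mL : m%:R * Lam 0 < 0 by rewrite pmulr_rlt0// ltr0n (ltn_trans _ m1).
    by apply: (cvgr_lt (m%:R * Lam 0) Ll).
  have : 0 @[y --> F] --> (1 : R).
    apply: cvg_trans df; apply: near_eq_cvg; apply: filterS Lneg => y Ly.
    by rewrite !lt0_powR1// subrr mul0r.
  move=> /(cvg_lim (@Rhausdorff R)); rewrite (cvg_lim (@Rhausdorff R) (cvg_cst _)) => /eqP.
  by rewrite eq_sym oner_eq0.
(* As [2 <= m], this [c] lies strictly between [Lam 0] and [m Lam 0]: near 0 the limit of [Lam] puts
   [Lam] above [c], while continuity of its power at 0 keeps that power below the power of [c]. *)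
pose c := 3 / 2 * Lam 0.
have cL : Lam 0 < c by rewrite /c; lra.
have fc : Lam 0 `^ p < c `^ p by rewrite gt0_ltr_powR// nnegrE ltW// (lt_trans L0).
have cm : c < m%:R * Lam 0.
  rewrite /c ltr_pM2r//; apply: (@lt_le_trans _ _ 2); last by rewrite (ler_nat _ 2).
  by lra.
have : \forall y \near F, c < Lam y by apply: (cvgr_gt (m%:R * Lam 0) Ll).
have : \forall y \near F, Lam y `^ p < c `^ p by apply: (cvgr_lt (Lam 0 `^ p) fl).
move=> /filterI H /H /filter_ex[y /= [y1 y2]].
have : c `^ p <= Lam y `^ p.
  have c0 : 0 < c by exact: lt_trans cL.
  by apply: ge0_ler_powR; rewrite ?nnegrE ?(ltW p0) ?(ltW c0) ?(ltW (lt_trans c0 y2)) ?(ltW y2).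
by rewrite leNgt y1.
Unshelve. all: by end_near. Qed.

(** Near 0 the difference quotient of the profile tends to 1, hence stays below 2. On the rest of
    the interval [Lam w g] is continuous by the differential equation, and [w g] is bounded below by
    compactness. *)
Lemma comparison_profile_bounds (R : realType) (m : nat) (I : set R) (w g h Lam : R -> R) (b : R) :
  (1 < m)%N -> comparison_data m I w g h Lam -> I b ->
  exists2 C : R, 0 < C & forall r, 0 < r <= b -> 0 <= Lam r `^ (m.-1%:R^-1) <= C * r.
Proof.
move=> m1 data Ib; have L0 := comparison_Lam0 m1 data.
have [bI [sw w0 w1 wpos] sh [sg g01 g0] [dq df]] := data.
have b0 := base_interval_ge0 bI Ib.
pose p : R := m.-1%:R^-1.
have p0 : 0 < p by rewrite invr_gt0 ltr0n -subn1 subn_gt0.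
have I0 : I 0 by apply: (base_interval_segment bI Ib); rewrite lexx.
have [d d0 hd] : exists2 d, 0 < d & forall r, I r -> 0 < r < d -> Lam r `^ p <= 2 * r.
  move: df; rewrite /is_derive_in L0 powR0 ?gt_eqF// => df.
  have : \forall y \near within (I `\ (0 : R)) (nbhs (0 : R)), (Lam y `^ p - 0) / (y - 0) < 2.
    by apply: (cvgr_lt (1 : R) df); rewrite ltr1n.
  rewrite near_withinE => /nbhs_ballP[d /= d0 hd]; exists d => // r Ir /andP[r0 rd].
  have : (Lam r `^ p - 0) / (r - 0) < 2.
    apply: hd; first by rewrite /ball/= sub0r normrN ger0_norm// ltW.
    by split => //= /eqP; rewrite gt_eqF.
  by rewrite !subr0 ltr_pdivrMr// => /ltW.
pose d' := d / 2.
have d'0 : 0 < d' by rewrite divr_gt0.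
have [C0 C00 hC] : exists2 C, 0 < C & forall r, d' <= r <= b -> Lam r `^ p <= C.
  have [bd|db] := ltP b d'.
    by exists 1 => // r /andP[r1 r2]; move: (le_lt_trans (le_trans r1 r2) bd); rewrite ltxx.
  have sub : `[d', b]%classic `<=` I.
    move=> r; rewrite /= in_itv/= => /andP[r1 r2]; apply: (base_interval_segment bI Ib).
    by rewrite r2 (le_trans (ltW d'0)).
  have sm u : smooth_in I u -> {within `[d', b], continuous u}.
    move=> su; apply: (is_derive_in_continuous (I := I)) => // x /sub Ix.
    exact: (su 0%N x Ix).
  have cq : {within `[d', b], continuous (fun x => Lam x * w x * g x)}.
    apply: (is_derive_in_continuous (I := I)) => // x /sub Ix.
    by eexists; exact: dq.
  have [r1 _ q1] := EVT_max db cq.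
  have [r2 r2I w2] := EVT_min db (sm _ sw).
  have [r3 r3I g3] := EVT_min db (sm _ sg).
  have w20 : 0 < w r2.
    by move: (r2I); rewrite in_itv/= => /andP[h1 _]; apply: wpos; [exact: sub|exact: lt_le_trans h1].
  have g30 : 0 < g r3 by have /andP[] := g01 _ (sub _ r3I).
  pose Q := Num.max 1 (Lam r1 * w r1 * g r1).
  have Q1 : 1 <= Q by rewrite le_max lexx.
  (* The maximum with 1 covers the points where [Lam r <= 1], in particular negative values, for
     which the power is 1. *)
  pose M := Num.max 1 (Q / (w r2 * g r3)).
  have M1 : 1 <= M by rewrite le_max lexx.
  exists (M `^ p); first by rewrite powR_gt0// (lt_le_trans ltr01).
  move=> r rdb; have rI : r \in `[d', b] by rewrite in_itv.
  have [Lr|Lr] := leP (Lam r) 1.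
    have [Lr0|Lr0] := leP 0 (Lam r).
      by apply: ge0_ler_powR; rewrite ?nnegrE ?(ltW p0)// ?(le_trans ler01)// (le_trans Lr).
    rewrite lt0_powR1//; have -> : (1 : R) = 1 `^ p by rewrite powR1.
    by apply: ge0_ler_powR; rewrite ?nnegrE ?(ltW p0)// (le_trans ler01).
  have Lr0 : 0 < Lam r by exact: lt_trans Lr.
  apply: ge0_ler_powR; rewrite ?nnegrE ?(ltW p0)// ?(ltW Lr0)// ?(le_trans ler01)//.
  rewrite le_max; apply/orP; right; rewrite ler_pdivlMr ?mulr_gt0//.
  apply: (@le_trans _ _ (Lam r * w r * g r)).
    rewrite -mulrA ler_wpM2l ?(ltW Lr0)//; apply: ler_pM; rewrite ?(ltW w20) ?(ltW g30)//.
      exact: w2.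
    exact: g3.
  by rewrite le_max q1// orbT.
exists (Num.max 2 (C0 / d')); first by rewrite lt_max ltr0n.
move=> r /andP[r0 rb]; rewrite powR_ge0/=.
have Ir : I r by apply: (base_interval_segment bI Ib); rewrite rb ltW.
have [rd|dr] := ltP r d.
  by apply: le_trans (hd r Ir _) _; rewrite ?r0// ler_wpM2r ?(ltW r0)// le_max lexx.
have d'r : d' <= r by apply: le_trans dr; rewrite /d' ler_pdivrMr// mulr_natr mulr2n lerDl ltW.
apply: le_trans (hC r _) _; first by rewrite d'r.
apply: (@le_trans _ _ (C0 / d' * r)); last by rewrite ler_wpM2r ?(ltW r0)// le_max lexx orbT.
by rewrite mulrAC ler_pdivlMr// ler_wpM2l// ltW.
Qed.

(** The same difference quotient exceeds [1/2] near 0. The bound on [g], from [g 0 = 1], is recorded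
    with it in order to compare [r] with [stretch g r]. *)
Lemma comparison_profile_lower (R : realType) (m : nat) (I : set R) (w g h Lam : R -> R) :
  (1 < m)%N -> comparison_data m I w g h Lam ->
  exists2 d : R, 0 < d & forall r, I r -> 0 < r < d -> r / 2 <= Lam r `^ (m.-1%:R^-1) /\ 2^-1 <= g r.
Proof.
move=> m1 data; have L0 := comparison_Lam0 m1 data.
have [bI _ _ [sg g01 g0] [_ df]] := data.
pose p : R := m.-1%:R^-1.
have p0 : 0 < p by rewrite invr_gt0 ltr0n -subn1 subn_gt0.
have [b b0 Ib] := base_interval_pos bI.
have I0 : I 0 by apply: (base_interval_segment bI Ib); rewrite lexx ltW.
have PF : ProperFilter (within (I `\ (0 : R)) (nbhs (0 : R))).
  apply: (segment_within_proper b0 (base_interval_segment bI Ib)).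
  by rewrite lexx ltW.
move: df; rewrite /is_derive_in L0 powR0 ?gt_eqF// => df.
have : \forall y \near within (I `\ (0 : R)) (nbhs (0 : R)), 2^-1 < (Lam y `^ p - 0) / (y - 0).
  by apply: (cvgr_gt (1 : R) df); lra.
have : \forall y \near within (I `\ (0 : R)) (nbhs (0 : R)), 2^-1 < g y.
  have := smooth_in_derive (k := 0) PF sg I0 => /= /is_derive_in_cvg; rewrite g0 => gl.
  by apply: (cvgr_gt (1 : R) gl); lra.
move=> /filterI H /H H'.
have : \forall y \near within (I `\ (0 : R)) (nbhs (0 : R)),
    2^-1 < g y /\ 2^-1 < (Lam y `^ p - 0) / (y - 0) by exact: H'.
rewrite near_withinE => /nbhs_ballP[d /= d0 hd]; exists d => // r Ir /andP[r0 rd].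
have [] : 2^-1 < g r /\ 2^-1 < (Lam r `^ p - 0) / (r - 0).
  apply: hd; first by rewrite /ball/= sub0r normrN ger0_norm// ltW.
  by split => //= /eqP; rewrite gt_eqF.
by rewrite !subr0 ltr_pdivlMr// mulrC => /ltW ? /ltW ?.
Qed.

(** * The change of variable [s(r)] and the warping function in the variable [s] *)

Lemma stretch_between (R : realType) (I : set R) (g : R -> R) (a c lo hi : R) :
  base_interval I -> smooth_in I g -> (forall r, I r -> 0 < g r <= 1) ->
  0 <= a -> a <= c -> I c -> (forall x, a < x <= c -> lo <= (g x)^-1 <= hi) ->
  lo * (c - a) <= stretch g c - stretch g a <= hi * (c - a).
Proof.
move=> bI sg g01 a0 ac Ic glh; rewrite /stretch.
have cg : {within `[0, c], continuous (fun x => (g x)^-1)}.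
  apply/subspace_continuousP => x /= xc.
  have Ix : I x by apply: (base_interval_segment bI Ic); rewrite in_itv/= in xc.
  have : {within `[0, c], continuous g}.
    apply: (is_derive_in_continuous (I := I)) => [y /=|y /= yc].
      by rewrite in_itv/=; exact: base_interval_segment.
    by apply: (sg 0%N); rewrite in_itv/= in yc; exact: (base_interval_segment bI Ic).
  move=> /subspace_continuousP/(_ x xc) h; apply: cvgV => //.
  by have /andP[/lt0r_neq0] := g01 x Ix.
have int : (@lebesgue_measure R).-integrable `[0, c] (EFin \o (fun x => (g x)^-1)).
  by apply: continuous_compact_integrable => //; exact: segment_compact.
have c0 : 0 <= c by exact: le_trans ac.
rewrite Rintegral_itvB//.
have int' : (@lebesgue_measure R).-integrable `]a, c] (EFin \o (fun x => (g x)^-1)).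
  apply: integrableS int => // x /=; rewrite !in_itv/= => /andP[ax ->].
  by rewrite (le_trans a0 (ltW ax)).
have len (k : R) : \int[@lebesgue_measure R]_(x in `]a, c]) (cst k x) = k * (c - a).
  rewrite Rintegral_cst//=; congr (_ * _); rewrite [X in fine X]lebesgue_measure_itv/= lte_fin.
  case: ltP => //= ca; apply/esym/eqP; rewrite subr_eq0 eq_le ac ca//.
have icst (k : R) : (@lebesgue_measure R).-integrable `]a, c] (EFin \o cst k).
  have : (@lebesgue_measure R).-integrable `[0, c] (EFin \o cst k).
    apply: continuous_compact_integrable; first exact: segment_compact.
    by apply: continuous_subspaceT => x; exact: cst_continuous.
  by apply: integrableS => // x /=; rewrite !in_itv/= => /andP[ax ->]; rewrite (le_trans a0 (ltW ax)).
apply/andP; split.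
  rewrite -len; apply: le_Rintegral => // x /=; rewrite in_itv/= => /glh /andP[]//.
rewrite -len; apply: le_Rintegral => // x /=; rewrite in_itv/= => /glh /andP[]//.
Qed.

Lemma stretch0 (R : realType) (g : R -> R) : stretch g 0 = 0.
Proof.
rewrite /stretch (_ : `[0, 0]%classic = [set (0 : R)]) ?Rintegral_set1//.
exact: set_itv1.
Qed.

(** The constant 1 on the left comes from [g <= 1]; it makes [stretch g] injective and at least the
    identity. On the right, [K] is the inverse of the minimum of [g] on [[0, b]]. *)
Lemma stretch_increment (R : realType) (I : set R) (g : R -> R) (b : R) :
  base_interval I -> smooth_in I g -> (forall r, I r -> 0 < g r <= 1) -> I b ->
  exists K, forall a c, 0 <= a -> a <= c -> c <= b ->
    c - a <= stretch g c - stretch g a <= K * (c - a).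
Proof.
move=> bI sg g01 Ib; have b0 := base_interval_ge0 bI Ib.
have cg : {within `[0, b], continuous g}.
  apply: (is_derive_in_continuous (I := I)) => [y /=|y /= yb].
    by rewrite in_itv/=; exact: base_interval_segment.
  by apply: (sg 0%N); rewrite in_itv/= in yb; exact: (base_interval_segment bI Ib).
have [x0 x0I gx0] := EVT_min b0 cg.
have Ix0 : I x0 by apply: (base_interval_segment bI Ib); rewrite in_itv/= in x0I.
exists (g x0)^-1 => a c a0 ac cb.
have Ic : I c by apply: (base_interval_segment bI Ib); rewrite cb (le_trans a0).
have := stretch_between (lo := 1) (hi := (g x0)^-1) bI sg g01 a0 ac Ic _.
rewrite mul1r; apply => x /andP[ax xc].
have x0' : 0 <= x <= b by rewrite (le_trans a0 (ltW ax)) (le_trans xc).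
have Ix : I x by exact: (base_interval_segment bI Ib).
have /andP[gx gx1] := g01 x Ix; have /andP[g0x _] := g01 x0 Ix0.
rewrite invf_ge1// gx1/= lef_pV2 ?posrE//; apply: gx0; rewrite in_itv.
exact: x0'.
Qed.

Lemma stretch_continuous (R : realType) (I : set R) (g : R -> R) (b : R) :
  base_interval I -> smooth_in I g -> (forall r, I r -> 0 < g r <= 1) -> I b ->
  {within `[0, b], continuous (stretch g)}.
Proof.
move=> bI sg g01 Ib; have [K hK] := stretch_increment bI sg g01 Ib.
apply/subspace_continuousP => x /=; rewrite in_itv/= => /andP[x0 xb].
apply/cvgrPdist_le => e e0; rewrite near_withinE.
pose K' := Num.max 1 K.
have K'0 : 0 < K' by rewrite lt_max ltr01.
have near_x : \forall y \near x, `|x - y| <= e / K'.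
  by move: (@cvg_id _ (nbhs x)) => /cvgrPdist_le; apply; rewrite divr_gt0.
near=> y; rewrite /= in_itv/= => /andP[y0 yb'].
have xy : `|x - y| <= e / K' by near: y.
have KK (z : R) : 0 <= z -> K * z <= K' * z by move=> z0; rewrite ler_wpM2r// le_max lexx orbT.
rewrite ler_pdivlMr// mulrC in xy.
have [xy'|yx] := leP x y.
  have /andP[h1 h2] := hK x y x0 xy' yb'.
  rewrite distrC ger0_norm; last by apply: le_trans h1; rewrite subr_ge0.
  apply: le_trans h2 _; apply: le_trans (KK _ _) _; first by rewrite subr_ge0.
  by rewrite distrC ger0_norm ?subr_ge0// in xy.
have /andP[h1 h2] := hK y x y0 (ltW yx) xb.
rewrite ger0_norm; last by apply: le_trans h1; rewrite subr_ge0 ltW.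
apply: le_trans h2 _; apply: le_trans (KK _ _) _; first by rewrite subr_ge0 ltW.
by rewrite ger0_norm ?subr_ge0 ?(ltW yx)// in xy.
Unshelve. all: by end_near. Qed.

(** The base is the image of an interval under a continuous map vanishing at 0; its downward closure
    is what keeps rays from the center inside the model. *)
Lemma comparison_base (R : realType) (m : nat) (I : set R) (g Lam : R -> R) (s t : R) :
  base_interval I -> smooth_in I g -> (forall r, I r -> 0 < g r <= 1) ->
  0 <= s <= t -> mbase (comparison_space m I g Lam) t -> mbase (comparison_space m I g Lam) s.
Proof.
move=> bI sg g01 /andP[s0 st] [b Ib bt]; have b0 := base_interval_ge0 bI Ib.
have [|r rb <-] := IVT (v := s) b0 (stretch_continuous bI sg g01 Ib).
  rewrite stretch0 bt; rewrite (min_idPl _) ?(max_idPr _) ?s0//; exact: le_trans st.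
by exists r => //; apply: (base_interval_segment bI Ib); rewrite in_itv/= in rb.
Qed.

Lemma mwarp_stretch (R : realType) (m : nat) (I : set R) (g Lam : R -> R) (r : R) :
  base_interval I -> smooth_in I g -> (forall r, I r -> 0 < g r <= 1) -> I r ->
  mwarp (comparison_space m I g Lam) (stretch g r) = Lam r `^ (m.-1%:R^-1).
Proof.
move=> bI sg g01 Ir /=; rewrite pinvKV ?inE// => x y; rewrite !inE => Ix Iy xy.
wlog le_xy : x y Ix Iy xy / x <= y.
  by move=> H; case: (leP x y) => [|/ltW] h; [exact: H|apply/esym; exact: H].
have [K hK] := stretch_increment bI sg g01 Iy.
have /andP[h _] := hK x y (base_interval_ge0 bI Ix) le_xy (lexx y).
by apply/eqP; rewrite eq_le le_xy/= -subr_le0 (le_trans h)// xy subrr.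
Qed.

(** If [s = stretch g r] then [r <= s], so a bound of the profile linear in [r] passes to [s] with
    the same constant. *)
Lemma comparison_warp_bounds (R : realType) (m : nat) (I : set R) (w g h Lam : R -> R) (T : R) :
  (1 < m)%N -> comparison_data m I w g h Lam ->
  mbase (comparison_space m I g Lam) T ->
  exists2 C : R, 0 < C & forall s, 0 < s <= T ->
    0 <= mwarp (comparison_space m I g Lam) s / s <= C.
Proof.
move=> m1 data [b Ib bT]; have [bI sw sh [sg g01 g0] dL] := data.
have [C C0 hC] := comparison_profile_bounds m1 data Ib; exists C => // s /andP[s0 sT].
have [r Ir rs] : mbase (comparison_space m I g Lam) s.
  by apply: (comparison_base bI sg g01 (t := T)); [rewrite ltW|exists b].
have r0 := base_interval_ge0 bI Ir.
have [K hK] := stretch_increment bI sg g01 Ir.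
have /andP[rs' _] := hK 0 r (lexx 0) r0 (lexx r).
rewrite !subr0 stretch0 subr0 rs in rs'.
have r_gt0 : 0 < r.
  by rewrite lt0r r0 andbT; apply: contraTneq s0 => r00; rewrite -rs r00 stretch0 ltxx.
(* Beyond [b] the function [stretch g] exceeds [T]. *)
have rb : r <= b.
  rewrite leNgt; apply/negP => br; have [K' hK'] := stretch_increment bI sg g01 Ir.
  have /andP[h1 _] := hK' b r (base_interval_ge0 bI Ib) (ltW br) (lexx r).
  move: h1; rewrite rs bT => h1; have : 0 < s - T by apply: lt_le_trans h1; rewrite subr_gt0.
  by rewrite subr_gt0 ltNge sT.
have /andP[f0 fC] := hC r (introT andP (conj r_gt0 rb)).
rewrite -rs mwarp_stretch// rs divr_ge0 ?(ltW s0)//= ler_pdivrMr//.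
by apply: le_trans fC _; rewrite ler_wpM2l// ltW.
Qed.

(** Near 0 the warping function is at least [r / 2], and [g >= 1/2] gives [s <= 2 r]; together they
    yield the factor [1/4]. *)
Lemma comparison_warp_lower (R : realType) (m : nat) (I : set R) (w g h Lam : R -> R) :
  (1 < m)%N -> comparison_data m I w g h Lam ->
  exists2 d : R, 0 < d & forall s, mbase (comparison_space m I g Lam) s -> 0 < s < d ->
    4^-1 <= mwarp (comparison_space m I g Lam) s / s.
Proof.
move=> m1 data; have [bI sw sh [sg g01 g0] dL] := data.
have [d d0 hd] := comparison_profile_lower m1 data; exists d => // s [r Ir rs] /andP[s0 sd].
have r0 := base_interval_ge0 bI Ir.
have [K hK] := stretch_increment bI sg g01 Ir.
have /andP[rs' _] := hK 0 r (lexx 0) r0 (lexx r).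
rewrite !subr0 stretch0 subr0 rs in rs'.
have r_gt0 : 0 < r.
  by rewrite lt0r r0 andbT; apply: contraTneq s0 => r00; rewrite -rs r00 stretch0 ltxx.
have [|fr _] := hd r Ir; first by rewrite r_gt0 (le_lt_trans rs').
have : stretch g r - stretch g 0 <= 2 * (r - 0).
  have /(_ _)/andP[] // := stretch_between (lo := 1) (hi := 2) bI sg g01 (lexx 0) r0 Ir.
  move=> x /andP[x0 xr]; have Ix : I x by apply: (base_interval_segment bI Ir); rewrite ltW.
  have [|_ gx] := hd x Ix; first by rewrite x0 (le_lt_trans xr)// (le_lt_trans rs').
  have /andP[gx0 gx1] := g01 x Ix.
  by rewrite invf_ge1// gx1/= -[leRHS]invrK lef_pV2 ?posrE// invr_gt0.
rewrite stretch0 !subr0 rs => sr.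
by rewrite -rs mwarp_stretch// rs ler_pdivlMr//; lra.
Qed.

(** * The volume density and the volume of balls *)

Lemma det_le (R : realType) (m : nat) (A : 'M[R]_m) (e : R) :
  (forall i j, `|A i j| <= e) -> `|\det A| <= m`!%:R * e ^+ m.
Proof.
move=> Ae; rewrite /determinant (le_trans (ler_norm_sum _ _ _))//.
rewrite mulr_natl -perm.card_Sn -sumr_const; apply: ler_sum => s _.
rewrite normrM normrX normrN1 expr1n mul1r normr_prod.
rewrite -[X in _ ^+ X](card_ord m) -prodr_const; apply: ler_prod => i _.
by rewrite normr_ge0 Ae.
Qed.

(** Matrix of the orthogonal projection onto the line of [x], and the zero matrix when [x] is 0. *)
Definition radial_mx (R : realType) (m : nat) (x : 'rV[R]_m) : 'M[R]_m :=
  enorm x ^- 2 *: (x^T *m x).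

(* [mgram] is [stretch_mx x (k ^+ 2)], the square of [stretch_mx x k], whose inverse is
   [stretch_mx x k^-1]: the square root of its determinant is bounded above and below through the
   entries of these two matrices. *)
Definition stretch_mx (R : realType) (m : nat) (x : 'rV[R]_m) (k : R) : 'M[R]_m :=
  radial_mx x + k *: (1%:M - radial_mx x).

Lemma radial_mx_idem (R : realType) (m : nat) (x : 'rV[R]_m) : x != 0 ->
  radial_mx x *m radial_mx x = radial_mx x.
Proof.
move=> x0; rewrite /radial_mx -scalemxAl -scalemxAr scalerA.
rewrite [x^T *m x *m (_ *m _)]mulmxA -[x^T *m x *m x^T]mulmxA.
rewrite [x *m x^T]mx11_scalar -/(dot x x) -enorm_dot mul_mx_scalar -scalemxAl scalerA.
congr (_ *: _); rewrite -mulrA mulVf ?mulr1// sqrf_eq0 enorm_eq0//.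
Qed.

(** [radial_mx x] and its complement are complementary projections, so only the factors on the
    complement multiply. *)
Lemma stretch_mxM (R : realType) (m : nat) (x : 'rV[R]_m) (k l : R) : x != 0 ->
  stretch_mx x k *m stretch_mx x l = stretch_mx x (k * l).
Proof.
move=> x0; rewrite /stretch_mx; move: (radial_mx_idem x0).
move: (radial_mx x) => r rr.
have r1 : r *m (1%:M - r) = 0 by rewrite mulmxBr mulmx1 rr subrr.
have r2 : (1%:M - r) *m r = 0 by rewrite mulmxBl mul1mx rr subrr.
have r3 : (1%:M - r) *m (1%:M - r) = 1%:M - r by rewrite mulmxBr mulmx1 r2 subr0.
rewrite mulmxDl !mulmxDr rr -!scalemxAr -!scalemxAl r1 r2 r3 !scaler0 addr0 add0r.
by rewrite scalerA mulrC.
Qed.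

Lemma mgram_stretch_mx (R : realType) (m : nat) (X : model R) (x : 'rV[R]_m) : x != 0 ->
  mgram X x = stretch_mx x ((mwarp X (enorm x) / enorm x) ^+ 2).
Proof. by move=> x0; rewrite /mgram (negbTE x0). Qed.

Lemma stretch_mx_entry (R : realType) (m : nat) (x : 'rV[R]_m) (k : R) (i j : 'I_m) :
  0 <= k -> `|stretch_mx x k i j| <= 1 + 2 * k.
Proof.
move=> k0; have re : `|radial_mx x i j| <= 1.
  have [->|x0] := eqVneq x 0.
    by rewrite /radial_mx trmx0 mul0mx scaler0 mxE normr0 ler01.
  have nx : 0 < enorm x by rewrite lt0r enorm_ge0 enorm_eq0 x0.
  rewrite /radial_mx !mxE big_ord1 !mxE normrM normfV normrX (ger0_norm (ltW nx)).
  rewrite mulrC ler_pdivrMr ?exprn_gt0// mul1r normrM expr2.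
  by apply: ler_pM => //; exact: coord_le_enorm.
rewrite /stretch_mx; move: (radial_mx x) re => r re.
rewrite !mxE (le_trans (ler_normD _ _))// lerD//.
rewrite normrM (ger0_norm k0) mulrC ler_wpM2r// (le_trans (ler_normB _ _))//.
have -> : (2 : R) = 1 + 1 by lra.
rewrite lerD//.
by case: (i == j); rewrite ?normr1 ?normr0.
Qed.

Lemma sqrt_det_stretch (R : realType) (m : nat) (x : 'rV[R]_m) (k : R) : x != 0 -> 0 <= k ->
  Num.sqrt (\det (stretch_mx x (k ^+ 2))) = `|\det (stretch_mx x k)|.
Proof. by move=> x0 k0; rewrite expr2 -stretch_mxM// det_mulmx -expr2 sqrtr_sqr. Qed.

Lemma sqrt_det_le (R : realType) (m : nat) (x : 'rV[R]_m) (k C : R) : x != 0 -> 0 <= k <= C ->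
  Num.sqrt (\det (stretch_mx x (k ^+ 2))) <= m`!%:R * (1 + 2 * C) ^+ m.
Proof.
move=> x0 /andP[k0 kC]; rewrite sqrt_det_stretch//; apply: det_le => i j.
by apply: le_trans (stretch_mx_entry _ _ _ k0) _; rewrite lerD2l ler_wpM2l.
Qed.

Lemma sqrt_det_ge (R : realType) (m : nat) (x : 'rV[R]_m) (k c : R) : x != 0 -> 0 < c <= k ->
  (m`!%:R * (1 + 2 * c^-1) ^+ m)^-1 <= Num.sqrt (\det (stretch_mx x (k ^+ 2))).
Proof.
move=> x0 /andP[c0 ck]; have k0 : 0 < k by exact: lt_le_trans ck.
rewrite sqrt_det_stretch ?(ltW k0)//.
have E : `|\det (stretch_mx x k)| * `|\det (stretch_mx x k^-1)| = 1.
  rewrite -normrM -det_mulmx stretch_mxM// divff ?gt_eqF// /stretch_mx scale1r addrC subrK.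
  by rewrite det1 normr1.
have D0 : 0 < `|\det (stretch_mx x k^-1)|.
  rewrite lt0r normr_ge0 andbT; apply/negP => /eqP D0; move: E; rewrite D0 mulr0 => /eqP.
  by rewrite eq_sym oner_eq0.
have -> : `|\det (stretch_mx x k)| = `|\det (stretch_mx x k^-1)|^-1.
  by apply: (mulIf (lt0r_neq0 D0)); rewrite E mulVf ?gt_eqF.
have up : `|\det (stretch_mx x k^-1)| <= m`!%:R * (1 + 2 * c^-1) ^+ m.
  apply: det_le => i j; apply: le_trans (stretch_mx_entry _ _ _ _) _; first by rewrite invr_ge0 ltW.
  by rewrite lerD2l ler_wpM2l// lef_pV2 ?posrE.
by rewrite lef_pV2 ?posrE// (lt_le_trans D0).
Qed.

(** Between radii [r <= s] the volume grows by at most [D] times the Lebesgue measure of the shell,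
    whence continuity. Since the volume is nondecreasing, positivity has to be checked for small
    balls only. *)
Lemma comparison_volume (R : realType) (m : nat) (lam : {measure set (borel 'rV[R]_m) -> \bar R})
    (I : set R) (w g h Lam : R -> R)
    (sigmaW : {measure set (borel 'rV[R]_m) -> \bar R}) (T : R) :
  (1 < m)%N -> is_lebesgue lam -> comparison_data m I w g h Lam ->
  is_mvolume lam (comparison_space m I g Lam) sigmaW ->
  mbase (comparison_space m I g Lam) T -> 0 <= T ->
  exists v : R -> R, [/\ forall r, 0 <= r <= T -> sigmaW [set x | enorm x < r] = (v r)%:E,
    v 0 = 0, forall r, 0 < r <= T -> 0 < v r & {within `[0, T], continuous v}].
Proof.
move=> m1 lamE data volE bT T0; have [bI sw sh [sg g01 g0] dL] := data.
set X := comparison_space m I g Lam in volE bT *.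
have m0 : (0 < m)%N by exact: ltn_trans m1.
have [c c0 cE] := lebesgue_ball m0 lamE.
have [C C0 hC] := comparison_warp_bounds m1 data bT.
have [d d0 hd] := comparison_warp_lower m1 data.
have base s : 0 <= s <= T -> mbase X s by move=> h'; exact: (comparison_base bI sg g01 h' bT).
(* The maximum with 1 accounts for the origin, where the Gram matrix is the identity by
   definition. *)
pose D : R := Num.max 1 (m`!%:R * (1 + 2 * C) ^+ m).
have D0 : 0 < D by rewrite lt_max ltr01.
have mB r : measurable ([set x | enorm x < r] : set (borel 'rV[R]_m)).
  by apply: (@measurable_open 'rV[R]_m); exact: enorm_lt_open.
have up (A : set (borel 'rV[R]_m)) : measurable A -> A `<=` [set x | enorm x < T] ->
    (sigmaW A <= D%:E * lam A)%E.
  move=> mA AT; rewrite volE//; last first.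
    by move=> x /AT /= xT; apply: base; rewrite enorm_ge0 ltW.
  apply: integral_le_cst => // x /AT /= xT; rewrite lee_fin.
  have [->|x0] := eqVneq x 0.
    by rewrite /mgram eqxx det1 sqrtr1 le_max lexx.
  rewrite mgram_stretch_mx// le_max; apply/orP; right; apply: sqrt_det_le => //.
  by apply: hC; rewrite (ltW xT) lt0r enorm_ge0 enorm_eq0 x0.
pose v r := fine (sigmaW [set x | enorm x < r]).
have vE r : 0 <= r <= T -> sigmaW [set x | enorm x < r] = (v r)%:E.
  move=> /andP[r0 rT]; rewrite fineK// ge0_fin_numE//.
  apply: (@le_lt_trans _ _ (D%:E * lam [set x | (enorm x < r)%R])%E).
    by apply: up => // x /= /lt_le_trans; apply.
  by rewrite cE// -EFinM ltry.
have v0 : v 0 = 0.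
  rewrite /v [X in sigmaW X](_ : _ = set0) ?measure0//.
  by rewrite -subset0 => x /=; rewrite ltNge enorm_ge0.
have mono r s : 0 <= r -> r <= s -> s <= T -> v r <= v s <= v r + D * c * (s ^+ m - r ^+ m).
  move=> r0 rs sT; have s0 : 0 <= s by exact: le_trans rs.
  have rsub : [set x : 'rV[R]_m | enorm x < r] `<=` [set x | enorm x < s].
    by move=> x /= /lt_le_trans; apply.
  have split_ (mu : {measure set (borel 'rV[R]_m) -> \bar R}) :
      mu [set x | enorm x < s] = (mu [set x | (enorm x < r)%R] +
        mu ([set x | (enorm x < s)%R] `\` [set x | (enorm x < r)%R]))%E.
    rewrite -measureU//; last 2 first.
    - exact: measurableD.
    - by rewrite setDIK.
    by rewrite setDUK.
  have mD' : measurable ([set x | (enorm x < s)%R] `\` [set x | (enorm x < r)%R] : set (borel 'rV[R]_m)).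
    exact: measurableD.
  set E := _ `\` _ in split_ mD'.
  have ET : E `<=` [set x | enorm x < T].
    by move=> x [/= h1 _]; exact: lt_le_trans h1 sT.
  have s1 := split_ sigmaW; have s2 := split_ lam.
  rewrite !vE ?r0 ?s0 ?sT ?(le_trans rs)// in s1.
  rewrite !cE// in s2.
  have lf : lam E = (c * s ^+ m - c * r ^+ m)%:E.
    move: s2; case: (lam E) (measure_ge0 lam E) => [a| |] //= _ [->].
    by congr EFin; ring.
  have sE := up E mD' ET; rewrite lf -EFinM in sE.
  have a0 : (0 <= sigmaW E)%E by exact: measure_ge0.
  move: s1 sE a0; case: (sigmaW E) => [a| |] //= [->].
  rewrite !lee_fin => aD a0; rewrite lerDl a0 lerD2l/=; apply: le_trans aD _.
  by rewrite -mulrA ler_wpM2l ?(ltW D0)// mulrBr.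
exists v; split => //.
- move=> r /andP[r0 rT].
  (* A smaller ball on which the lower bound of the warping function is available. *)
  pose r' := Num.min r (d / 2).
  have r'0 : 0 < r' by rewrite lt_min r0 divr_gt0.
  have r'r : r' <= r by rewrite ge_min lexx.
  have r'd : r' < d by rewrite gt_min; apply/orP; right; lra.
  have /andP[] := mono r' r (ltW r'0) r'r rT.
  have r'T : 0 <= r' <= T by rewrite ltW//= (le_trans r'r).
  move=> vr _; apply: lt_le_trans vr.
  (* [4^-1] is the lower bound of [W(s)/s] from [comparison_warp_lower]; the minimum with 1 again
     accounts for the origin. *)
  pose k : R := Num.min 1 (m`!%:R * (1 + 2 * 4^-1^-1) ^+ m)^-1.
  have k0 : 0 < k.
    by rewrite lt_min ltr01 invr_gt0 mulr_gt0 ?ltr0n ?fact_gt0// exprn_gt0// ltr_pwDl.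
  rewrite -lte_fin -vE//.
  apply: (@lt_le_trans _ _ (k%:E * lam [set x | (enorm x < r')%R])%E).
    by rewrite cE ?(ltW r'0)// -EFinM lte_fin !mulr_gt0// exprn_gt0.
  rewrite volE//; last by move=> x /= h1; apply: base; rewrite enorm_ge0 (le_trans (ltW h1))//; case/andP: r'T.
  apply: integral_ge_cst => //; first exact: ltW.
  move=> x /= xr; rewrite lee_fin.
  have [->|x0] := eqVneq x 0.
    by rewrite /mgram eqxx det1 sqrtr1 ge_min lexx.
  rewrite mgram_stretch_mx// ge_min; apply/orP; right; apply: sqrt_det_ge => //.
  rewrite invr_gt0 ltr0n/=; apply: hd.
    by apply: base; rewrite enorm_ge0 (le_trans (ltW xr))//; case/andP: r'T.
  by rewrite lt0r enorm_ge0 enorm_eq0 x0/= (lt_trans xr).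
- apply/subspace_continuousP => x /=; rewrite in_itv/= => /andP[x0 xT].
  have cX : (fun y : R => D * c * (y ^+ m - x ^+ m)) @ x --> D * c * (x ^+ m - x ^+ m).
    apply: cvgM; first exact: cvg_cst.
    apply: cvgB; last exact: cvg_cst.
    exact: exprn_continuous.
  rewrite subrr mulr0 in cX.
  apply/cvgrPdist_le => e e0; rewrite near_withinE.
  have near_x : \forall y \near x, `|0 - D * c * (y ^+ m - x ^+ m)| <= e.
    by move: cX => /cvgrPdist_le; apply.
  apply: filterS near_x => y; rewrite sub0r normrN => ye; rewrite /= in_itv/= => /andP[y0 yT].
  apply: le_trans ye; have Dc : 0 <= D * c by rewrite mulr_ge0// ltW.
  have [xy|yx] := leP x y.
    have /andP[h1 h2] := mono x y x0 xy yT.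
    by rewrite distrC ger0_norm ?subr_ge0//; apply: le_trans (ler_norm _); rewrite lerBlDl.
  have /andP[h1 h2] := mono y x y0 (ltW yx) xT.
  rewrite ger0_norm ?subr_ge0// -normrN; apply: le_trans (ler_norm _).
  by rewrite -mulrN opprB lerBlDl.
Qed.

(** * Positivity of the solution *)

Lemma cvg_within_sub (R : realType) (A B : set R) (x l : R) (f : R -> R) :
  A `<=` B -> f @ within B (nbhs x) --> l -> f @ within A (nbhs x) --> l.
Proof.
move=> AB /cvgrPdist_le fl; apply/cvgrPdist_le => e e0.
have := fl e e0; rewrite !near_withinE; apply: filterS => y + Ay; apply; exact: AB.
Qed.

Lemma is_derive_in_interior (R : realType) (a b : R) (f : R -> R) (x l : R) :
  a < x < b -> is_derive_in `[a, b] f x l -> is_derive x 1 f l.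
Proof.
move=> /andP[ax xb] fl.
have cv : (fun h : R => h^-1 *: ((f \o shift x) (h *: (1 : R)) - f x)) @ 0^' --> l.
  apply/cvgrPdist_le => e e0; move: fl => /cvgrPdist_le /(_ e e0).
  rewrite near_withinE => /nbhs_ballP[d /= d0 hd].
  have d'0 : 0 < Num.min d (Num.min (x - a) (b - x)).
    by rewrite !lt_min d0 !subr_gt0 ax xb.
  near=> h.
  have h0 : h != 0 by near: h; exact: nbhs_dnbhs_neq.
  have : `|h| < Num.min d (Num.min (x - a) (b - x)) by near: h; exact: dnbhs0_lt.
  rewrite !lt_min => /andP[hd1 /andP[hd2 hd3]].
  have := hd (h + x) _ _; rewrite addrK [h *: 1]mulr1 /= mulrC; apply.
    by rewrite /ball/= opprD addrCA subrr addr0 normrN.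
  move: hd2 hd3; rewrite !ltr_norml => /andP[h1 _] /andP[_ h2].
  split; first by rewrite in_itv/=; apply/andP; split; lra.
  by move=> /eqP; rewrite -subr_eq0 addrK (negbTE h0).
by apply: DeriveDef; [apply/cvg_ex; exists l|exact: cvg_lim].
Unshelve. all: by end_near. Qed.

Lemma smooth_in_continuous (R : realType) (I : set R) (f : R -> R) :
  smooth_in I f -> {within I, continuous f}.
Proof. by move=> sf; apply: (is_derive_in_continuous (I := I)) => // x Ix; exact: (sf 0%N). Qed.

(** The derivative vanishes at [x] and is negative just after it, so by the mean value theorem [f]
    drops to the right of [x]. Looking to the right only, the argument covers the left end point
    together with interior points. *)
Lemma not_min_of_derivatives (R : realType) (a b : R) (f : R -> R) (x : R) :
  a < b -> smooth_in `[a, b] f -> a <= x < b ->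
  derive_in `[a, b] f x = 0 -> derive_in `[a, b] (derive_in `[a, b] f) x < 0 ->
  exists2 y, a <= y <= b & f y < f x.
Proof.
move=> ab sf /andP[ax xb]; set J := `[a, b]%classic => d1 d2.
have Jx : J x by rewrite /J/= in_itv/= ax ltW.
have seg y : a <= y <= b -> J y by rewrite /J/= in_itv.
have PF y : J y -> ProperFilter (within (J `\ y) (nbhs y)).
  by move=> Jy; apply: (segment_within_proper ab seg); rewrite /J/= in_itv/= in Jy.
have fd y : J y -> is_derive_in J f y (derive_in J f y).
  by move=> Jy; exact: (@smooth_in_derive _ _ _ _ 0 (PF y Jy) sf Jy).
have := @smooth_in_derive _ _ _ _ 1 (PF x Jx) sf Jx; rewrite /is_derive_in/= d1 => fd2.
have : \forall y \near within (J `\ x) (nbhs x), (derive_in J f y - 0) / (y - x) < 0.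
  exact: (cvgr_lt _ fd2).
rewrite near_withinE => /nbhs_ballP[d /= d0 hd].
pose y := Num.min b (x + d / 2).
have xy : x < y by rewrite lt_min xb ltrDl divr_gt0.
have yb : y <= b by rewrite ge_min lexx.
have yd : y < x + d by rewrite gt_min; apply/orP; right; lra.
exists y; first by rewrite (le_trans ax (ltW xy)).
have [z] : exists2 z, z \in `]x, y[ & f y - f x = derive_in J f z * (y - x).
  apply: MVT => // [z|].
    rewrite in_itv/= => /andP[xz zy]; apply: (is_derive_in_interior (a := a) (b := b)).
      by rewrite (le_lt_trans ax xz) (lt_le_trans zy).
    by apply: fd; apply: seg; rewrite (le_trans ax (ltW xz)) (le_trans (ltW zy)).
  apply: continuous_subspaceW (smooth_in_continuous sf) => z /=.
  rewrite in_itv/= => /andP[xz zy]; apply: seg.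
  by rewrite (le_trans ax xz) (le_trans zy).
rewrite in_itv/= => /andP[xz zy] fyx.
have : (derive_in J f z - 0) / (z - x) < 0.
  apply: hd.
    by rewrite /ball/= distrC ger0_norm ?subr_ge0 ?(ltW xz)// ltrBlDl (lt_trans zy).
  split; first by apply: seg; rewrite (le_trans ax (ltW xz)) (le_trans (ltW zy)).
  by move=> /= /eqP; rewrite gt_eqF.
rewrite subr0 pmulr_llt0 ?invr_gt0 ?subr_gt0// => dz.
by rewrite -subr_lt0 fyx pmulr_llt0// subr_gt0.
Qed.

(* At an interior minimum the equation gives [psi'' < 0]; at 0, where its coefficient is singular,
   passing to the limit gives [psi' = 0] and [psi'' = -1/m].  So the minimum is attained at [rad]. *)
Lemma Lop_solution_ge0 (R : realType) (m : nat) (I : set R) (w g h : R -> R) (rad : R)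
    (psi : R -> R) :
  (1 < m)%N -> base_interval I -> warping I w -> smooth_in I h -> smooth_in I g ->
  (forall r, I r -> 0 < g r <= 1) -> g 0 = 1 -> 0 < rad -> I rad ->
  smooth_in `[0, rad] psi ->
  (forall r, 0 < r <= rad -> Lop m I w g h `[0, rad] psi r = -1) ->
  psi rad = 0 -> forall r, 0 <= r <= rad -> 0 <= psi r.
Proof.
move=> m1 bI [sw w0 w1 wpos] sh sg g01 g0 rad0 Irad sp pE pb.
set J := `[0, rad]%classic in sp pE.
have JI : J `<=` I by move=> x; rewrite /J/= in_itv/=; exact: base_interval_segment.
have [r0 r0J pmin] := EVT_min (ltW rad0) (smooth_in_continuous sp).
move: (r0J); rewrite in_itv/= => /andP[r00 r0r].
suff p0 : 0 <= psi r0 by move=> r rr; apply: le_trans p0 (pmin _ _); rewrite in_itv.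
rewrite leNgt; apply/negP => pneg.
have r0rad : r0 < rad.
  by rewrite lt_neqAle r0r andbT; apply/eqP => E; move: pneg; rewrite E pb ltxx.
have PF y : J y -> ProperFilter (within (J `\ y) (nbhs y)).
  move=> Jy; apply: (segment_within_proper rad0); last by rewrite /J/= in_itv/= in Jy.
  by move=> z; rewrite /J/= in_itv.
have PI y : I y -> y <= rad -> ProperFilter (within (I `\ y) (nbhs y)).
  move=> Iy yr; apply: (segment_within_proper rad0) (base_interval_segment bI Irad) _.
  by rewrite yr (base_interval_ge0 bI Iy).
have sder k y : J y -> is_derive_in J (iter k (derive_in J) psi) y (iter k.+1 (derive_in J) psi y).
  by move=> Jy; exact: (smooth_in_derive (PF y Jy) sp Jy).
suff [d1 d2] : derive_in J psi r0 = 0 /\ derive_in J (derive_in J psi) r0 < 0.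
  have [|y yr] := not_min_of_derivatives rad0 sp _ d1 d2; first by rewrite r00.
  by rewrite ltNge pmin// in_itv.
have [r0E|r0_gt0] : r0 = 0 \/ 0 < r0.
  by move: r00; rewrite le_eqVlt => /predU1P[<-|]; [left|right].
  rewrite {}r0E in r0J r00 r0r r0rad pneg pmin *.
  have J0 : J 0 by [].
  have I0 := JI 0 J0.
  set F := within (J `\ (0 : R)) (nbhs (0 : R)).
  have PF0 : ProperFilter F by exact: PF.
  have PI0 := PI 0 I0 (ltW rad0).
  have sub : J `\ (0 : R) `<=` I `\ (0 : R) by move=> y [/JI ? ?].
  have npos : \forall y \near F, [/\ J y, 0 < y & I y].
    rewrite near_withinE; near=> y => -[Jy /eqP/= y0]; split => //; last exact: JI.
    by move: Jy; rewrite /J/= in_itv/= lt0r y0 => /andP[].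
  have wl : (w y / y) @[y --> F] --> (1 : R).
    apply: cvg_within_sub sub _.
    have := smooth_in_derive (k := 0) PI0 sw I0; rewrite /= w1 /is_derive_in w0.
    by under eq_fun do rewrite !subr0.
  have dwl : derive_in I w y @[y --> F] --> (1 : R).
    apply: cvg_within_sub sub _.
    by have := smooth_in_derive (k := 1) PI0 sw I0 => /= /is_derive_in_cvg; rewrite w1.
  have gl : g y @[y --> F] --> (1 : R).
    apply: cvg_within_sub sub _.
    by have := smooth_in_derive (k := 0) PI0 sg I0 => /= /is_derive_in_cvg; rewrite g0.
  have hl : h y @[y --> F] --> h 0.
    apply: cvg_within_sub sub _.
    by have := smooth_in_derive (k := 0) PI0 sh I0 => /= /is_derive_in_cvg.
  have yl : y @[y --> F] --> (0 : R) by apply: cvg_within_filter; exact: cvg_id.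
  have p1l : derive_in J psi y @[y --> F] --> derive_in J psi 0.
    by have /= /is_derive_in_cvg := sder 1%N 0 J0.
  have p2l : derive_in J (derive_in J psi) y @[y --> F] --> derive_in J (derive_in J psi) 0.
    by have /= /is_derive_in_cvg := sder 2%N 0 J0.
  (* This is [y] times the singular coefficient of the first derivative in the operator, arranged
     through [w y / y] so that it converges, to [m - 1]. *)
  pose A y := (m%:R - g y ^+ 2) * (derive_in I w y * (w y / y)^-1) - m%:R * h y * y.
  have Al : A y @[y --> F] --> (m%:R - 1 * 1) * (1 * 1^-1) - m%:R * h 0 * 0.
    apply: cvgB; last by apply: cvgM => //; apply: cvgM => //; exact: cvg_cst.
    apply: cvgM; last by apply: cvgM => //; apply: cvgV => //; exact: oner_neq0.
    by apply: cvgB; [exact: cvg_cst|apply: cvgM].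
  rewrite !mulr1 mulr0 subr0 invr1 !mulr1 in Al.
  have FF : Filter F by exact: filter_filter.
  pose cM := @cvgM R _ F FF; pose cD := @cvgD R R _ F FF.
  have eqn : \forall y \near F,
      derive_in J psi y * A y + y * (derive_in J (derive_in J psi) y * (g y * g y) + 1) = 0.
    apply: filterS npos => y [Jy y0 Iy]; have wy := wpos y Iy y0.
    have yr : 0 < y <= rad by rewrite y0; move: Jy; rewrite /J/= in_itv/= => /andP[].
    have := pE y yr; rewrite /Lop /A -/J => E.
    have -> : derive_in J (derive_in J psi) y * (g y * g y) + 1 =
      - (derive_in J psi y * ((m%:R - g y ^+ 2) * (derive_in I w y / w y) - m%:R * h y)).
      by apply/eqP; rewrite -subr_eq0 opprK -expr2 addrAC E addNr.
    by field; rewrite !gt_eqF.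
  (* In the equation multiplied by [y] only [psi'(0) (m - 1) = 0] survives at the limit, and
     [1 < m]. *)
  have d10 : derive_in J psi 0 = 0.
    have : (derive_in J psi y * A y + y * (derive_in J (derive_in J psi) y * (g y * g y) + 1))
       @[y --> F] --> derive_in J psi 0 * (m%:R - 1) +
         0 * (derive_in J (derive_in J psi) 0 * (1 * 1) + 1).
      have c3 : 1 @[y --> F] --> (1 : R) by exact: cvg_cst.
      exact: cD (cM _ _ _ _ p1l Al) (cM _ _ _ _ yl (cD _ _ _ _ (cM _ _ _ _ p2l (cM _ _ _ _ gl gl)) c3)).
    move=> /(cvg_lim (@Rhausdorff R)); rewrite (lim_near_cst (@Rhausdorff R) eqn) mul0r addr0.
    move=> /esym/eqP; rewrite mulf_eq0 => /orP[/eqP//|].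
    by rewrite subr_eq0 -[1]/(1%:R) eqr_nat gtn_eqF.
  split=> //.
  (* Since the first derivative vanishes at 0, its quotient by [y] tends to the second derivative;
     the limit of the equation is then [(m - 1) psi'' + psi'' = -1] at 0. *)
  have ql : (derive_in J psi y / y) @[y --> F] --> derive_in J (derive_in J psi) 0.
    have := sder 1%N 0 J0; rewrite /= /is_derive_in d10.
    by under eq_fun do rewrite !subr0.
  have eqn2 : \forall y \near F,
      derive_in J psi y / y * A y + derive_in J (derive_in J psi) y * (g y * g y) = -1.
    apply: filterS (filterI npos eqn) => y [[_ y0 _] E].
    apply: (mulIf (lt0r_neq0 y0)); apply/eqP; rewrite -subr_eq0 -[X in _ == X]E; apply/eqP.
    by field; rewrite gt_eqF.
  have : (derive_in J psi y / y * A y + derive_in J (derive_in J psi) y * (g y * g y))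
     @[y --> F] --> derive_in J (derive_in J psi) 0 * (m%:R - 1) +
       derive_in J (derive_in J psi) 0 * (1 * 1).
    exact: cD (cM _ _ _ _ ql Al) (cM _ _ _ _ p2l (cM _ _ _ _ gl gl)).
  move=> /(cvg_lim (@Rhausdorff R)); rewrite (lim_near_cst (@Rhausdorff R) eqn2) !mulr1.
  rewrite mulrBr mulr1 subrK => E.
  have mpos : (0 : R) < m%:R by rewrite ltr0n (ltn_trans _ m1).
  by rewrite -(pmulr_llt0 _ mpos) -E ltrN10.
have Jr0 : J r0 by [].
have Ir0 := JI r0 Jr0.
have d1 : derive_in J psi r0 = 0.
  have [_ <-] : is_derive r0 1 psi (derive_in J psi r0).
    by apply: (is_derive_in_interior (a := 0) (b := rad)); [rewrite r0_gt0|exact: (sder 0%N)].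
  have [] : is_derive r0 (1 : R) psi 0; last by [].
  apply: (derive1_at_min (ltW rad0)) => [t||t].
  - rewrite in_itv/= => /andP[t0 tr].
    have [] // : is_derive t 1 psi (derive_in J psi t).
    apply: (is_derive_in_interior (a := 0) (b := rad)); first by rewrite t0.
    by apply: (sder 0%N); rewrite /J/= in_itv/= !ltW.
  - by rewrite in_itv/= r0_gt0.
  - by rewrite in_itv/= => /andP[t0 tr]; apply: pmin; rewrite in_itv/= !ltW.
split=> //.
have := pE r0; rewrite r0_gt0 r0r => /(_ isT); rewrite /Lop -/J d1 mul0r addr0 => E.
have /andP[gp _] := g01 r0 Ir0.
have g2 : 0 < g r0 ^+ 2 by rewrite exprn_gt0.
by rewrite -(pmulr_llt0 _ g2) E ltrN10.
Unshelve. all: by end_near. Qed.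

(** * Level sets on the submanifold matched with balls of the comparison space *)

Lemma open_extrinsic_ball (R : realType) (m n : nat) (P : riemannian R m) (N : riemannian R n)
    (phi : P -> N) (p : N) (o : P) (rad : R) :
  continuous phi -> open (extrinsic_ball phi p o rad).
Proof.
move=> cphi; apply: open_component_manifold.
apply: (@open_comp _ _ (fun x => rdist p (phi x)) [set t | t < rad]); last exact: open_lt.
by move=> x _; apply: continuous_comp; [exact: cphi|exact: rdist_continuous].
Qed.

Lemma mballE (R : realType) (m : nat) (X : model R) (rho : R) :
  (forall s t : R, 0 <= s <= t -> mbase X t -> mbase X s) -> mbase X rho ->
  @mball R m X rho = [set x | enorm x < rho].
Proof.
move=> Xdown Xrho; apply/seteqP; split => x /=.
  by move=> [Xx]; rewrite mdistE// lte_fin.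
move=> xr; have Xx : Defs.mset X x by apply: Xdown Xrho; rewrite enorm_ge0 ltW.
by split => //; rewrite mdistE// lte_fin.
Qed.

Theorem theorem4p4 (R : realType) (n m : nat) (m_gt1 : (1 < m)%N)
  (N : riemannian R n) (N_complete : complete N)
  (p : N) (p_pole : pole p)
  (P : riemannian R m) (P_complete : complete P)
  (phi : P -> N) (phi_immersion : immersion phi)
  (phi_induced : induced_metric phi) (P_unbounded : unbounded_in phi p)
  (o : P) (phi_o : phi o = p)
  (lam : {measure set (borel 'rV[R]_m) -> \bar R}) (lam_leb : is_lebesgue lam)
  (sigma : {measure set (borel P) -> \bar R}) (sigma_vol : is_volume lam sigma)
  (I : set R) (w g h Lam : R -> R) (I_data : comparison_data m I w g h Lam)
  (sigmaW : {measure set (borel 'rV[R]_m) -> \bar R})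
  (sigmaW_vol : is_mvolume lam (comparison_space m I g Lam) sigmaW)
  (rad : R) (rad_gt0 : 0 < rad) (rad_I : I rad)
  (D_precompact : precompact (extrinsic_ball phi p o rad))
  (T : R) (T_base : mbase (comparison_space m I g Lam) T)
  (T_vol : sigmaW (mball (comparison_space m I g Lam) T)
           = sigma (extrinsic_ball phi p o rad))
  (psi : R -> R) (psi_smooth : smooth_in `[0, rad] psi)
  (psi_eq : forall r, 0 < r <= rad -> Lop m I w g h `[0, rad] psi r = -1)
  (psi_bd : psi rad = 0) :
  (\int[sigma]_(x in extrinsic_ball phi p o rad) (psi (rdist p (phi x)))%:E
   = \int[sigmaW]_(x in mball (comparison_space m I g Lam) T)
       (sym_fun sigma (comparison_space m I g Lam) sigmaW
          (extrinsic_ball phi p o rad) (fun y => psi (rdist p (phi y))) x)%:E)%E.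

Proof.
have [bI sw sh [sg g01 g0] _] := I_data.
set X := comparison_space m I g Lam in sigmaW_vol T_base T_vol *.
set D := extrinsic_ball phi p o rad in D_precompact T_vol *.
set F := fun y => psi (rdist p (phi y)).
have [cphi _] := phi_immersion.
have Xdown (s t : R) : 0 <= s <= t -> mbase X t -> mbase X s by exact: (comparison_base bI sg g01).
have ball rho : mbase X rho -> @mball R m X rho = [set x | enorm x < rho] by exact: mballE.
have base_ge0 rho : mbase X rho -> 0 <= rho.
  move=> [r Ir <-]; have [K hK] := stretch_increment bI sg g01 Ir.
  have r0 := base_interval_ge0 bI Ir.
  have /andP[h1 _] := hK 0 r (lexx 0) r0 (lexx r).
  by move: h1; rewrite stretch0 !subr0; exact: le_trans.
have T0 := base_ge0 T T_base.
have [v [vE v0 vpos cv]] := comparison_volume m_gt1 lam_leb I_data sigmaW_vol T_base T0.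
have oD : open D by exact: open_extrinsic_ball.
have mD : measurable (D : set (borel P)) by exact: measurable_open.
have Dr x : D x -> 0 <= rdist p (phi x) < rad.
  by move=> /connected_component_sub Dx; rewrite rdist_ge0.
have F0 x : D x -> 0 <= F x.
  move=> /Dr /andP[x0 xr].
  apply: (Lop_solution_ge0 m_gt1 bI sw sh sg g01 g0 rad_gt0 rad_I psi_smooth psi_eq psi_bd).
  by rewrite x0 ltW.
have cpsi := smooth_in_continuous psi_smooth.
have [r0 _ r0max] := EVT_max (ltW rad_gt0) cpsi.
have FM x : D x -> F x <= psi r0.
  by move=> /Dr /andP[x0 xr]; apply: r0max; rewrite in_itv/= x0 ltW.
(* [psi] is known to be continuous only relative to [[0, rad]]; on the open set [D] the distance
   stays in this interval, so strict superlevel sets in [D] are open. *)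
have mF : measurable_fun (D : set (borel P)) (F : borel P -> R).
  apply: measurable_fun_gt => t; apply: measurable_open; rewrite openE => x [Dx /= tx].
  have nD : nbhs x D by exact: open_nbhs_nbhs.
  have xJ : `[0, rad]%classic (rdist p (phi x)).
    by have /andP[h1 h2] := Dr x Dx; rewrite /= in_itv/= h1 ltW.
  move: cpsi => /subspace_continuousP/(_ _ xJ) cx.
  have : \forall s \near within `[0, rad] (nbhs (rdist p (phi x))), t < psi s.
    exact: (cvgr_gt _ cx).
  rewrite near_withinE => npsi.
  have cr : {for x, continuous (fun y => rdist p (phi y))}.
    by apply: continuous_comp; [exact: cphi|exact: rdist_continuous].
  apply: filterS (filterI nD (cr _ npsi)) => y [Dy /= h1]; split => //=; apply: h1.
  by have /andP[h2 h3] := Dr y Dy; rewrite /= in_itv/= h2 ltW.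
(* Finiteness of the volume of [D] is obtained from the ball of equal volume. *)
have sD : sigma D = (v T)%:E by rewrite -T_vol ball// vE// T0 lexx.
pose Dt (t : R) : set P := [set y | D y /\ t <= F y].
have mDt t : measurable (Dt t : set (borel P)).
  rewrite (_ : Dt t = D `&` F @^-1` `[t, +oo[%classic).
    by apply: mF => //; exact: measurable_itv.
  by apply/seteqP; split => x /=; rewrite in_itv/= andbT.
(* Exactly the set from which [sym_set] draws its radius, so that [rho t] is the radius occurring in
   [sym_fun]. *)
pose S t := [set rho | mbase X rho /\ sigmaW (@mball R m X rho) = sigma (Dt t)].
pose rho t := xget 0 (S t).
have rhoP t : S t (rho t).
  (* A radius exists by the intermediate value theorem for [v] on [[0, T]], the volume of the level
     set lying between 0 and that of [D]; the default of [xget] is thus never returned for want of a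
     radius. *)
  apply: xgetPex.
  have le_D : (sigma (Dt t) <= sigma D)%E.
    by apply: le_measure; rewrite ?inE// => x [].
  have ge_0 : (0 <= sigma (Dt t))%E by exact: measure_ge0.
  have fin : sigma (Dt t) = (fine (sigma (Dt t)))%:E.
    by rewrite fineK// ge0_fin_numE// (le_lt_trans le_D)// sD ltry.
  rewrite fin in ge_0 le_D *; rewrite sD !lee_fin in ge_0 le_D.
  have [|r rT vr] := IVT (v := fine (sigma (Dt t))) T0 cv.
    rewrite v0 (min_idPl _) ?(max_idPr _) ?ge_0//; exact: le_trans le_D.
  rewrite in_itv/= in rT.
  have Xr : mbase X r by exact: Xdown rT T_base.
  by exists r; split => //; rewrite ball// vE// vr.
have volD : sigmaW [set x | enorm x < T] = sigma D by rewrite -T_vol ball.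
rewrite ball//.
rewrite (@integral_symmetrization _ _ _ _ R sigma sigmaW D F (psi r0) (@enorm R m) T rho) //.
- apply: eq_integral => x _; congr (sup _)%:E; apply/seteqP; split => t [t0 h1]; split => //.
    by rewrite /sym_set -/(S t) -/(rho t) ball//; case: (rhoP t).
  by move: h1; rewrite /sym_set -/(S t) -/(rho t) ball//; case: (rhoP t).
- by move=> x Dx; rewrite F0// FM.
- exact: enorm_ge0.
- by move=> r; apply: measurable_open; exact: enorm_lt_open.
- by rewrite sD ltry.
- by move=> t t0; have [Xr <-] := rhoP t; rewrite ball.
(* Above the maximum of [psi] the level set is empty; as every ball of positive radius has positive
   volume, the radius chosen for it is 0, and the set defining [sym_fun] is bounded. *)
- move=> t Mt; have [Xr] := rhoP t.
  have -> : Dt t = set0.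
    by rewrite -subset0 => x [/FM Fx]; rewrite leNgt (le_lt_trans Fx).
  rewrite measure0 ball// => vol0; rewrite leNgt; apply/negP => rt0.
  have [v' [v'E _ v'pos _]] :=
    comparison_volume m_gt1 lam_leb I_data sigmaW_vol Xr (ltW rt0).
  move: vol0; rewrite v'E ?(ltW rt0) ?lexx// => -[] /eqP.
  by rewrite gt_eqF// v'pos// rt0 lexx.
Qed.
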